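(* Let $u$ be a positive classical solution of $\partial_t u+(-\Delta)^{1/2}u=0$ on $\mathbb{R}\times(0,T)$. Given $0<t_1,t_2<T$ and $x_1,x_2\in\mathbb{R}$, we have $$\left(\frac{t_1}{t_2}\right) C_*\leq\frac{u(x_2,t_2)}{u(x_1,t_1)}\leq \left(\frac{t_1}{t_2}\right)C^*,$$ with $$C_*=\frac{\sqrt{\kappa_0}-(t_2-t_1)(t_2+t_1)-|x_2-x_1|^2} {\sqrt{\kappa_0}-(t_2-t_1)(t_2+t_1)+|x_2-x_1|^2},\qquad C^*=\frac{\sqrt{\kappa_0}+(t_2-t_1)(t_2+t_1)+|x_2-x_1|^2} {\sqrt{\kappa_0}+(t_2-t_1)(t_2+t_1)-|x_2-x_1|^2},$$ where $$\kappa_0=\Big(|x_2-x_1|^2+|t_2-t_1|^2\Big)\Big(|x_2-x_1|^2+|t_2+t_1|^2\Big).$$ Moreover, $$C_*=\frac{x_1-x_*}{x_2-x_*}\quad\text{and}\quad C^*=\frac{x_1-x^*}{x_2-x^*},$$ where $x_*,x^*\in\mathbb{R}$ satisfy $$\left(\frac{t_1}{t_2}\right)C_*=\frac{k(x_2-x_*,t_2)}{k(x_1-x_*,t_1)}\quad\text{and}\quad \frac{k(x_2-x^*,t_2)}{k(x_1-x^*,t_1)}=\left(\frac{t_1}{t_2}\right)C^*.$$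
   Context: Here $0<T\le\infty$, and the times $t_1,t_2$ need not be ordered or different. The operator is the one-dimensional half-Laplacian acting in the variable $x$: $$(-\Delta)^{1/2}f(x)=\frac{1}{\pi}\,\mathrm{P.V.}\int_{\mathbb{R}}\frac{f(x)-f(y)}{|x-y|^{2}}\,dy .$$ A positive classical solution on $\mathbb{R}\times(0,T)$ is a function $u:\mathbb{R}\times(0,T)\to(0,\infty)$ such that $u$ and $\partial_t u$ are continuous on $\mathbb{R}\times(0,T)$ and the equation $\partial_t u+(-\Delta)^{1/2}u=0$ holds pointwise at every $(x,t)\in\mathbb{R}\times(0,T)$. No further restriction is imposed on the spatial growth of $u$ or on the initial data. The function $k$ is the fractional heat kernel $$k(x,t)=\frac{1}{\pi t}\left(\frac{1}{1+\frac{|x|^2}{t^2}}\right),\qquad x\in\mathbb{R},\ t>0.$$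
   Formalization: The factor t1/t2 is replaced by t2/t1 in all four places (u=1, t1=1, t2=2, x1=0, x2=1 violates the original); where C_* or C^* reads 0/0 (only if x1=x2) it means its limit as |x2-x1| tends to 0+; the ''Moreover'' part is stated for x1≠x2, as it fails or is undefined when x1=x2. *)

(* Defs.v *)
From HB Require Import structures.
From mathcomp Require Import all_boot all_order all_algebra.
From mathcomp Require Import all_classical all_reals all_analysis.
Import Order.TTheory GRing.Theory Num.Theory.
Import numFieldNormedType.Exports.

Set Implicit Arguments.
Unset Strict Implicit.
Unset Printing Implicit Defensive.

Local Open Scope classical_set_scope.
Local Open Scope ring_scope.

Section half_laplacian.
Context {R : realType}.
Implicit Types (f : R -> R) (x l e : R).

Definition pv_domain x e : set R := [set y | e < `|x - y|].

Definition pv_integrand f x : R -> R := fun y => (f x - f y) / `|x - y| ^+ 2.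

(* (-Delta)^{1/2} f(x) exists as a principal value and equals l.  The first
   clause is the absolute convergence of each truncated integral; it is needed
   because Rintegral takes junk values on non-integrable functions. *)
Definition is_half_laplacian f x l : Prop :=
  (forall e, 0 < e ->
     (@lebesgue_measure R).-integrable (pv_domain x e)
       (EFin \o pv_integrand f x)) /\
  pi^-1 * (\int[@lebesgue_measure R]_(y in pv_domain x e) pv_integrand f x y)
    @[e --> 0^'+] --> l.

End half_laplacian.

Section solution.
Context {R : realType}.
Implicit Types (T : \bar R) (u : R -> R -> R).

Definition time_strip T : set (R * R) := [set p | 0 < p.2 /\ (p.2%:E < T)%E].

(* u x t is only constrained for 0 < t < T. *)
Definition positive_classical_solution T u : Prop :=
  [/\ forall x t : R, 0 < t -> (t%:E < T)%E -> 0 < u x t,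
      {within time_strip T, continuous (fun p : R * R => u p.1 p.2)},
      forall x t : R, 0 < t -> (t%:E < T)%E -> derivable (u x) t 1,
      {within time_strip T, continuous (fun p : R * R => derive1 (u p.1) p.2)} &
      forall x t : R, 0 < t -> (t%:E < T)%E ->
        exists2 l, is_half_laplacian (fun y => u y t) x l
                 & derive1 (u x) t + l = 0].

End solution.

Section harnack_constants.
Context {R : realType}.
Implicit Types t d x : R.

Definition heat_kernel x t : R :=
  1 / (pi * t) * (1 / (1 + `|x| ^+ 2 / t ^+ 2)).

(* d stands for |x2 - x1|. *)
Definition kappa0 t1 t2 d : R :=
  (d ^+ 2 + `|t2 - t1| ^+ 2) * (d ^+ 2 + `|t2 + t1| ^+ 2).

Definition low_num t1 t2 d : R :=
  Num.sqrt (kappa0 t1 t2 d) - (t2 - t1) * (t2 + t1) - d ^+ 2.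
Definition low_den t1 t2 d : R :=
  Num.sqrt (kappa0 t1 t2 d) - (t2 - t1) * (t2 + t1) + d ^+ 2.
Definition up_num t1 t2 d : R :=
  Num.sqrt (kappa0 t1 t2 d) + (t2 - t1) * (t2 + t1) + d ^+ 2.
Definition up_den t1 t2 d : R :=
  Num.sqrt (kappa0 t1 t2 d) + (t2 - t1) * (t2 + t1) - d ^+ 2.

(* For t1, t2 > 0 the denominators vanish only if d = 0 (and t1 <= t2, resp.
   t2 <= t1), where the quotient reads 0 / 0; it is then understood as its
   limit as d tends to 0 from the right. *)
Definition C_low t1 t2 x1 x2 : R :=
  let d := `|x2 - x1| in
  if low_den t1 t2 d == 0
  then lim (low_num t1 t2 r / low_den t1 t2 r @[r --> 0^'+])
  else low_num t1 t2 d / low_den t1 t2 d.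

Definition C_up t1 t2 x1 x2 : R :=
  let d := `|x2 - x1| in
  if up_den t1 t2 d == 0
  then lim (up_num t1 t2 r / up_den t1 t2 r @[r --> 0^'+])
  else up_num t1 t2 d / up_den t1 t2 d.

(* k(x2 - z, t2) / k(x1 - z, t1), which equals
   (t2 / t1) * (|x1 - z|^2 + t1^2) / (|x2 - z|^2 + t2^2).  At a critical point
   in z its value is (t2 / t1) * (x1 - z) / (x2 - z); hence the factor t2 / t1,
   not t1 / t2, in front of C_low and C_up.  With t1 / t2 the bounds already
   fail for the constant solution u = 1, t1 = 1, t2 = 2, x1 = 0, x2 = 1. *)
Definition kernel_ratio t1 t2 x1 x2 z : R :=
  heat_kernel (x2 - z) t2 / heat_kernel (x1 - z) t1.

End harnack_constants.

(* Main.v *)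
(** The bounds say that u at two points differs at most by the factor exp of their
    hyperbolic distance in the half-plane, as is true of each kernel k(x - z, t)
    (the worst z makes a discriminant vanish), hence of every positive
    superposition of kernels.  So it suffices to approximate u locally uniformly
    by finite superpositions, which uses the maximum principle alone.  Truncate
    u(., s) to a large interval and approximate it by a superposition v.
    Comparison at infinity, where v decays, gives v <= u + eta for later times.
    This lower bound controls int_n^(n+1) u(y, t) dy by u(x, t2) for n <= x <= n + 1
    and t < t2, so the tails of int u(y, t) / y^2 dy are small uniformly in t.
    Finally w = u - v + eta >= 0 is small initially on |x| < X and has small tails,
    and comparing it with dl * (X x^2 / (X^2 - x^2) + 12 t), which is infinite at
    |x| = X, gives w small on compact sets without any growth hypothesis. *)

Require Import Defs.
From HB Require Import structures.
From mathcomp Require Import all_boot all_order all_algebra.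
From mathcomp Require Import all_classical all_reals all_analysis.
From mathcomp Require Import measurable_realfun ring lra.
Import Order.TTheory GRing.Theory Num.Theory.
Import numFieldNormedType.Exports.

Local Open Scope classical_set_scope.
Local Open Scope ring_scope.

Set Implicit Arguments.
Unset Strict Implicit.

(** * Symmetric shells *)

(** The truncated integrals in the definition make [u(y, t) / y^2] integrable at infinity for each
    single [t], with no uniformity in [t] and no pointwise bound in [y]. So [u] cannot be bounded
    from above by comparison at infinity. Positivity has to supply the missing control: bounds from
    below come first and are then turned into bounds on the tails. Nothing is known at time 0, so
    everything starts at a small [s > 0]. A kernel sum matched to [u] at time [s] has a small age
    [eps] there and is followed at age [t + (eps - s)]. The inequality for kernels is thus applied
    at slightly shifted times, and continuity of the constant in the times removes the shift. Since
    that inequality survives finite nonnegative sums and locally uniform approximation, no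
    representing measure or initial trace is constructed. In the equation the barrier costs at most
    [10 * k], while it grows at rate [12 * k] in time, where [k = 40 ^+ 2 * dl]; the factor
    [40 ^+ 2] comes from splitting the half-Laplacian at one twentieth of the distance to
    [|x| = X]. *)

Lemma measurable_addl {R : realType} (x : R) :
  measurable_fun [set: R] (fun z : R => x + z).
Proof. exact: measurable_funD. Qed.

Lemma measurable_subl {R : realType} (x : R) :
  measurable_fun [set: R] (fun z : R => x - z).
Proof. exact: measurable_funB. Qed.

Lemma lebesgue_measure_addl {R : realType} (x : R) (A : set R) :
  measurable A ->
  pushforward lebesgue_measure ((fun z => x + z) : _ -> measurableTypeR R) A
  = lebesgue_measure A.
Proof.
move=> mA; apply/esym/lebesgue_measure_unique => //=.
  exact: measurable_addl.
move=> mx _ [[a b]] _ <-.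
rewrite /pushforward.
have -> : (fun z => x + z) @^-1` `]a, b]%classic = `]a - x, b - x]%classic.
  by apply/seteqP; split => y /=; rewrite !in_itv/=; lra.
rewrite !lebesgue_measure_itv/= !lte_fin ltrD2r; case: ifP => // _.
by rewrite -!EFinD; congr EFin; lra.
Qed.

Lemma lebesgue_measure_subl {R : realType} (x : R) (A : set R) :
  measurable A ->
  pushforward lebesgue_measure ((fun z => x - z) : _ -> measurableTypeR R) A
  = lebesgue_measure A.
Proof.
move=> mA; apply/esym/lebesgue_measure_unique => //=.
  exact: measurable_subl.
move=> mx _ [[a b]] _ <-.
rewrite /pushforward.
have -> : (fun z => x - z) @^-1` `]a, b]%classic = `[x - b, x - a[%classic.
  by apply/seteqP; split => y /=; rewrite !in_itv/=; lra.
rewrite !lebesgue_measure_itv/= !lte_fin ltrD2l ltrN2; case: ifP => // _.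
by rewrite -!EFinD; congr EFin; lra.
Qed.

Lemma ge0_integral_preserving {R : realType} (phi : R -> R) (D : set R)
    (f : R -> \bar R) (mphi : measurable_fun [set: R] phi)
    (phiE : forall A : set R, measurable A ->
       pushforward lebesgue_measure (phi : _ -> measurableTypeR R) A
       = lebesgue_measure A) :
  measurable D -> measurable_fun D f -> {in D, forall y, (0 <= f y)%E} ->
  (\int[lebesgue_measure]_(y in D) f y
   = \int[lebesgue_measure]_(z in phi @^-1` D) f (phi z))%E.
Proof.
move=> mD mf f0.
pose phi' : measurableTypeR R -> measurableTypeR R := phi.
have mphi' : measurable_fun [set: measurableTypeR R] phi' by exact: mphi.
rewrite -[RHS](ge0_integral_pushforward mphi' lebesgue_measure mD mf f0).
by apply: eq_measure_integral => //= A mA _; exact/esym/phiE.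
Qed.

Lemma integrable_preserving {R : realType} (phi : R -> R) (D : set R)
    (f : R -> \bar R) (mphi : measurable_fun [set: R] phi)
    (phiE : forall A : set R, measurable A ->
       pushforward lebesgue_measure (phi : _ -> measurableTypeR R) A
       = lebesgue_measure A) :
  measurable D -> (@lebesgue_measure R).-integrable D f ->
  (@lebesgue_measure R).-integrable (phi @^-1` D) (f \o phi) /\
  (\int[lebesgue_measure]_(y in D) f y
   = \int[lebesgue_measure]_(z in phi @^-1` D) f (phi z))%E.
Proof.
move=> mD intf.
have mf : measurable_fun D f by exact: measurable_int intf.
have mphiD : measurable (phi @^-1` D).
  by rewrite -[X in measurable X]setTI; exact: mphi.
have mfphi : measurable_fun (phi @^-1` D) (f \o phi).
  apply: (measurable_comp mD) => //; first by move=> _ [z Dz <-].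
  exact: measurable_funTS.
split.
  apply/integrableP; split => //.
  move/integrableP : intf => [_].
  rewrite (ge0_integral_preserving mphi phiE)//.
  exact: measurableT_comp.
rewrite integralE [RHS]integralE; congr (_ - _)%E.
- transitivity (\int[lebesgue_measure]_(z in phi @^-1` D) (f^\+ (phi z)))%E.
    by apply: ge0_integral_preserving => //; exact: measurable_funepos.
  by apply: eq_integral => z _; rewrite !funeposE.
- transitivity (\int[lebesgue_measure]_(z in phi @^-1` D) (f^\- (phi z)))%E.
    by apply: ge0_integral_preserving => //; exact: measurable_funeneg.
  by apply: eq_integral => z _; rewrite !funenegE.
Qed.

Lemma measurable_shell {R : realType} (x : R) (E : set R) :
  measurable E -> measurable [set y : R | E `|x - y|].
Proof.
move=> mE.
have : measurable_fun [set: R] (fun y : R => `|x - y|).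
  by apply: measurableT_comp => //; exact: measurable_subl.
by move=> /(_ measurableT _ mE); rewrite setTI.
Qed.

Lemma shellE {R : realType} (x : R) (E : set R) : E `<=` `]0, +oo[ ->
  [set y : R | E `|x - y|] =
  (fun y => - x + y) @^-1` E `|` (fun y => x - y) @^-1` E.
Proof.
move=> E0; apply/seteqP; split => y /=.
  by case: ger0P => _ H; [right|left; rewrite addrC -opprB].
case=> H; have := E0 _ H; rewrite /= in_itv/= andbT => h0.
  by rewrite distrC gtr0_norm// addrC.
by rewrite gtr0_norm.
Qed.

Lemma shell_disj {R : realType} (x : R) (E : set R) : E `<=` `]0, +oo[ ->
  [disjoint ((fun y => - x + y) @^-1` E) & ((fun y => x - y) @^-1` E)].
Proof.
move=> E0; apply/disj_setPS => y [] /= /E0 + /E0.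
by rewrite /= !in_itv/=; lra.
Qed.

Lemma integrable_shell {R : realType} (x : R) (E : set R) (f : R -> R) :
  measurable E -> E `<=` `]0, +oo[ ->
  (@lebesgue_measure R).-integrable [set y | E `|x - y|] (EFin \o f) ->
  (@lebesgue_measure R).-integrable E (EFin \o (fun z => f (x + z))) /\
  (@lebesgue_measure R).-integrable E (EFin \o (fun z => f (x - z))).
Proof.
move=> mE E0 intf.
have mD := measurable_shell x mE.
have [ip _] := integrable_preserving (measurable_addl x)
  (lebesgue_measure_addl x) mD intf.
have [im _] := integrable_preserving (measurable_subl x)
  (lebesgue_measure_subl x) mD intf.
split; [apply: integrableS ip|apply: integrableS im] => //.
- rewrite -[X in measurable X]setTI; exact: (measurable_addl x).
- move=> z Ez /=; have := E0 _ Ez; rewrite /= in_itv/= andbT => z0.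
  by rewrite opprD addrA subrr add0r normrN gtr0_norm.
- rewrite -[X in measurable X]setTI; exact: (measurable_subl x).
- move=> z Ez /=; have := E0 _ Ez; rewrite /= in_itv/= andbT => z0.
  by rewrite opprB addrC subrK gtr0_norm.
Qed.

Lemma integrable_shell_inv {R : realType} (x : R) (E : set R) (f : R -> R) :
  measurable E -> E `<=` `]0, +oo[ ->
  (@lebesgue_measure R).-integrable E (EFin \o (fun z => f (x + z))) ->
  (@lebesgue_measure R).-integrable E (EFin \o (fun z => f (x - z))) ->
  (@lebesgue_measure R).-integrable [set y | E `|x - y|] (EFin \o f).
Proof.
move=> mE E0 ip im.
have [{}ip _] := integrable_preserving (measurable_addl (- x))
  (lebesgue_measure_addl (- x)) mE ip.
have [{}im _] := integrable_preserving (measurable_subl x)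
  (lebesgue_measure_subl x) mE im.
rewrite shellE//.
have mp : measurable ((fun y => - x + y) @^-1` E).
  by rewrite -[X in measurable X]setTI; exact: (measurable_addl (- x)).
have mm : measurable ((fun y => x - y) @^-1` E).
  by rewrite -[X in measurable X]setTI; exact: (measurable_subl x).
move: ip im => /integrableP[mfp ip] /integrableP[mfm im].
have ep : EFin \o (fun z : R => f (x + z)) \o +%R (- x) = EFin \o f.
  by apply/funext => y /=; rewrite addrA subrr add0r.
have em : (EFin \o (fun z : R => f (x - z))) \o (fun y => x - y) = EFin \o f.
  by apply/funext => y /=; rewrite opprB addrC subrK.
rewrite ep in mfp; rewrite em in mfm.
have mf : measurable_fun ((fun y => - x + y) @^-1` E `|` (fun y => x - y) @^-1` E)
   (EFin \o f) by apply/measurable_funU.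
apply/integrableP; split => //.
rewrite ge0_integral_setU//; last 2 first.
- exact: measurableT_comp.
- exact: shell_disj.
have -> : (fun x : R => `|(EFin \o f) x|)%E = (fun x => `|(f x)%:E|)%E by [].
apply: lte_add_pinfty.
- by move: ip; under eq_integral do rewrite /= addrA subrr add0r.
- by move: im; under eq_integral do rewrite /= opprB addrC subrK.
Qed.

(** Folding about [x]: the shell is a translate of [E] together with a disjoint reflected copy. In
    the folded integrand the terms odd in [y - x] cancel, which is what makes principal values
    computable. *)
Lemma Rintegral_shell {R : realType} (x : R) (E : set R) (f : R -> R) :
  measurable E -> E `<=` `]0, +oo[ ->
  (@lebesgue_measure R).-integrable [set y | E `|x - y|] (EFin \o f) ->
  \int[lebesgue_measure]_(y in [set y | E `|x - y|]) f y =
  \int[lebesgue_measure]_(z in E) (f (x + z) + f (x - z)).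
Proof.
move=> mE E0 intf.
have [ip im] := integrable_shell mE E0 intf.
rewrite RintegralD//.
have mp : measurable ((fun y => - x + y) @^-1` E).
  by rewrite -[X in measurable X]setTI; exact: (measurable_addl (- x)).
have mm : measurable ((fun y => x - y) @^-1` E).
  by rewrite -[X in measurable X]setTI; exact: (measurable_subl x).
have [_ ep] := integrable_preserving (measurable_addl (- x))
  (lebesgue_measure_addl (- x)) mE ip.
have [_ em] := integrable_preserving (measurable_subl x)
  (lebesgue_measure_subl x) mE im.
rewrite shellE// in intf *.
rewrite Rintegral_setU//; last exact: shell_disj.
congr (_ + _); rewrite /Rintegral; congr fine.
- apply: etrans (esym ep); apply: eq_integral => y _ /=.
  by rewrite addrA subrr add0r.
- apply: etrans (esym em); apply: eq_integral => y _ /=.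
  by rewrite opprB addrC subrK.
Qed.

(** * The half-Laplacian of the heat kernel *)

Lemma ge0_ray_FTC {R : realType} (f F : R -> R) (e l : R) :
  0 < e -> (forall z, e <= z -> 0 <= f z) ->
  (forall z, 0 < z -> {for z, continuous f}) ->
  (forall z : R, 0 < z -> is_derive z 1 F (f z)) ->
  F z @[z --> +oo] --> l ->
  (@lebesgue_measure R).-integrable `]e, +oo[ (EFin \o f) /\
  \int[lebesgue_measure]_(z in `]e, +oo[) f z = l - F e.
Proof.
move=> e0 f0 cf dF Fl.
have cF z : 0 < z -> {for z, continuous F}.
  by move=> z0; apply/differentiable_continuous/derivable1_diffP; case: (dF _ z0).
have cfe : {within `[e, +oo[, continuous f}.
  apply/continuous_within_itvcyP; split => [z|].
    by rewrite in_itv/= andbT => ez; apply: cf; exact: lt_trans ez.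
  exact/cvg_at_right_filter/cf.
have E : (\int[lebesgue_measure]_(z in `[e, +oo[) (f z)%:E = l%:E - (F e)%:E)%E.
  apply: ge0_continuous_FTC2y => //.
  - by move=> z ez; case: (dF z (lt_trans e0 ez)).
  - exact/cvg_at_right_filter/cF.
  - move=> z; rewrite in_itv/= andbT => ez; rewrite derive1E.
    by case: (dF z (lt_trans e0 ez)).
have int : (@lebesgue_measure R).-integrable `[e, +oo[ (EFin \o f).
  apply/integrableP; split.
    by apply/measurable_EFinP; exact: subspace_continuous_measurable_fun.
  have -> : (\int[lebesgue_measure]_(z in `[e, +oo[) `|(EFin \o f) z|
      = \int[lebesgue_measure]_(z in `[e, +oo[) (f z)%:E)%E.
    apply: eq_integral => z; rewrite inE/= in_itv/= andbT => ez.
    by congr EFin; rewrite ger0_norm// f0.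
  by rewrite E -EFinB ltry.
have int' : (@lebesgue_measure R).-integrable `]e, +oo[ (EFin \o f).
  apply: integrableS int => //.
  by move=> z /=; rewrite !in_itv/= !andbT => /ltW.
by split => //; rewrite Rintegral_itv_obnd_cbnd// /Rintegral E.
Qed.

Lemma cvgy_inv {R : realType} : (z^-1 : R) @[z --> +oo] --> 0.
Proof.
apply/cvgrPdist_lt => /= eps eps0; near=> z.
have z0 : 0 < z by near: z; exact: nbhs_pinfty_gt.
rewrite sub0r normrN gtr0_norm ?invr_gt0// invf_plt ?posrE//.
by near: z; apply: nbhs_pinfty_gt; exact: num_real.
Unshelve. all: by end_near. Qed.

Lemma is_deriveNV {R : realType} (z : R) : 0 < z ->
  is_derive z 1 (fun y : R => - y^-1) (z ^- 2).
Proof.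
move=> z0; have zn0 : z != 0 by rewrite gt_eqF.
apply: is_derive_eq; first by apply: is_deriveN; apply: is_deriveV.
by rewrite -[RHS]mulr1 scaleNr opprK.
Qed.

Lemma ray_inv2 {R : realType} (e : R) : 0 < e ->
  (@lebesgue_measure R).-integrable `]e, +oo[ (EFin \o (fun z => z ^- 2)) /\
  \int[lebesgue_measure]_(z in `]e, +oo[) (z ^- 2) = e^-1.
Proof.
move=> e0.
have := @ge0_ray_FTC R (fun z => z ^- 2) (fun z => - z^-1) e 0 e0.
rewrite sub0r opprK; apply.
- by move=> z ez; rewrite invr_ge0 exprn_ge0// (le_trans (ltW e0)).
- by move=> z z0; apply: cvgV; [rewrite expf_neq0// gt_eqF|exact: exprn_continuous].
- exact: is_deriveNV.
- by rewrite -oppr0; apply: cvgN; exact: cvgy_inv.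
Qed.

(** The version for nonnegative integrands is applied to [f z + C * z ^- 2], and the known integral
    of [C * z ^- 2] is then subtracted. *)
Lemma ray_FTC {R : realType} (f F : R -> R) (C e l : R) :
  0 < e -> (forall z, e <= z -> `|f z| <= C * z ^- 2) ->
  (forall z, 0 < z -> {for z, continuous f}) ->
  (forall z : R, 0 < z -> is_derive z 1 F (f z)) ->
  F z @[z --> +oo] --> l ->
  (@lebesgue_measure R).-integrable `]e, +oo[ (EFin \o f) /\
  \int[lebesgue_measure]_(z in `]e, +oo[) f z = l - F e.
Proof.
move=> e0 fC cf dF Fl.
have [i0 E0] := ray_inv2 e0.
have [||||ig Eg] :=
    @ge0_ray_FTC R (fun z => f z + C * z ^- 2) (fun z => F z + C * - z^-1) e l e0.
- by move=> z ez; rewrite -lerBlDr sub0r; move: (fC z ez); rewrite ler_norml => /andP[].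
- move=> z z0; apply: cvgD; first exact: cf.
  apply: cvgM; first exact: cvg_cst.
  by apply: cvgV; [rewrite expf_neq0// gt_eqF|exact: exprn_continuous].
- move=> z z0; apply: is_deriveD; first exact: dF.
  by apply: is_deriveZ; exact: is_deriveNV.
- rewrite -[l]addr0; apply: cvgD => //; rewrite -(mulr0 C); apply: cvgM.
    exact: cvg_cst.
  by rewrite -oppr0; apply: cvgN; exact: cvgy_inv.
have iC : (@lebesgue_measure R).-integrable `]e, +oo[
    (EFin \o (fun z => C * z ^- 2)).
  have -> : EFin \o (fun z : R => C * z ^- 2) =
    (fun z => C%:E * (EFin \o (fun z => z ^- 2)) z)%E by apply/funext.
  exact: integrableZl.
have fE : f = (fun z => (f z + C * z ^- 2) - C * z ^- 2).
  by apply/funext => z; rewrite addrK.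
split.
  rewrite fE.
  have -> : EFin \o (fun z : R => f z + C * z ^- 2 - C * z ^- 2) =
    ((EFin \o (fun z => f z + C * z ^- 2)%R) \- (EFin \o (fun z => C * z ^- 2)%R))%E.
    by apply/funext.
  exact: integrableB.
rewrite fE RintegralB// Eg RintegralZl// E0; ring.
Qed.

Lemma pv_domainE {R : realType} (x e : R) :
  pv_domain x e = [set y | [set` `]e, +oo[%R] `|x - y|].
Proof. by apply/seteqP; split => y /=; rewrite /pv_domain /= in_itv/= andbT. Qed.

Lemma heat_kernelE {R : realType} (x t : R) : 0 < t ->
  heat_kernel x t = t / pi / (t ^+ 2 + x ^+ 2).
Proof.
move=> t0; have t2 : 0 < t ^+ 2 + x ^+ 2 by rewrite ltr_pwDl ?exprn_gt0 ?sqr_ge0.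
rewrite /heat_kernel real_normK ?num_real//.
have := pi_gt0 R; move: (pi : R) => P P0; field.
by rewrite !gt_eqF// addrC.
Qed.

Lemma ln_affine_cvg {R : realType} (p t : R) : 0 < t ->
  (ln (t ^+ 2 + (p + z) ^+ 2) - ln (t ^+ 2 + (p - z) ^+ 2)) @[z --> +oo] --> (0:R).
Proof.
move=> t0; have t2 : 0 < t ^+ 2 by rewrite exprn_gt0.
have pos (y : R) : 0 < t ^+ 2 + y ^+ 2 by rewrite ltr_pwDl ?sqr_ge0.
(* The quotient of the two arguments of [ln], after division by [z ^+ 2], as a function of
   [w = z^-1]. *)
pose r (w : R) := ((t ^+ 2 + p ^+ 2) * w ^+ 2 + 2 * p * w + 1)
               / ((t ^+ 2 + p ^+ 2) * w ^+ 2 + (- (2 * p)) * w + 1).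
have r0 : r 0 = 1 by rewrite /r; field.
have cq (b : R) : (fun w : R => (t ^+ 2 + p ^+ 2) * w ^+ 2 + b * w + 1) w @[w --> (0:R)]
    --> (fun w : R => (t ^+ 2 + p ^+ 2) * w ^+ 2 + b * w + 1) 0.
  apply: cvgD; last exact: cvg_cst.
  apply: cvgD.
    apply: cvgM; [exact: cvg_cst|exact: exprn_continuous].
  by apply: cvgM; [exact: cvg_cst|exact: cvg_id].
have cr : r z @[z --> (0:R)] --> (1:R).
  rewrite -r0 /r; apply: cvgM; first exact: cq.
  apply: cvgV; last exact: cq.
  by rewrite expr0n !mulr0 !add0r oner_neq0.
have cl : ln (r z^-1) @[z --> +oo] --> (0:R).
  rewrite -ln1; apply: continuous_cvg; first exact: continuous_ln.
  apply: cvg_comp cr; exact: cvgy_inv.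
apply: cvg_trans cl; apply: near_eq_cvg; near=> z.
have z0 : 0 < z by near: z; exact: nbhs_pinfty_gt.
rewrite -ln_div ?posrE//; congr ln; rewrite /r; field.
by rewrite !gt_eqF.
Unshelve. all: by end_near. Qed.

Lemma cvgy_affine {R : realType} (p t : R) : 0 < t ->
  ((p + z) / t) @[z --> +oo] --> +oo.
Proof.
move=> t0; apply/cvgryPgt => A; near=> z.
rewrite ltr_pdivlMr//; suff : A * t - p < z by lra.
by near: z; apply: nbhs_pinfty_gt; exact: num_real.
Unshelve. all: by end_near. Qed.

Lemma atan_affine_cvg {R : realType} (p t : R) : 0 < t ->
  (atan ((p + z) / t) - atan ((p - z) / t)) @[z --> +oo] --> (pi : R).
Proof.
move=> t0; rewrite [X in _ --> X](_ : pi = pi / 2 - - (pi / 2)); last first.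
  by have := pi_gt0 R; move: (pi : R) => P _; field.
apply: cvgB; first exact: (cvg_comp _ _ (cvgy_affine p t0) (@cvgy_atan R)).
rewrite (_ : (fun z => atan ((p - z) / t)) = (fun z => - atan ((- p + z) / t))); last first.
  by apply/funext => z; rewrite -atanN -mulNr opprD opprK.
by apply: cvgN; exact: (cvg_comp _ _ (cvgy_affine (- p) t0) (@cvgy_atan R)).
Qed.

(* The antiderivative in z of [2 k(p) - k(p + z) - k(p - z)] / z^2 for
   k(p) = 1 / (t^2 + p^2). *)
Definition kernel_primitive {R : realType} (p t z : R) : R :=
  (t ^+ 2 + p ^+ 2) ^- 2 *
  ((t ^+ 2 - p ^+ 2) / t * (atan ((p + z) / t) - atan ((p - z) / t))
   - p * (ln (t ^+ 2 + (p + z) ^+ 2) - ln (t ^+ 2 + (p - z) ^+ 2))).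

Lemma is_derive_kernel_primitive {R : realType} (p t z : R) : 0 < t -> 0 < z ->
  is_derive z 1 (kernel_primitive p t)
    (((t ^+ 2 + p ^+ 2)^-1 - (t ^+ 2 + (p + z) ^+ 2)^-1) / z ^+ 2 +
     ((t ^+ 2 + p ^+ 2)^-1 - (t ^+ 2 + (p - z) ^+ 2)^-1) / z ^+ 2).
Proof.
move=> t0 z0.
have pos (y : R) : 0 < t ^+ 2 + y ^+ 2 by rewrite ltr_pwDl ?exprn_gt0 ?sqr_ge0.
have d1 : is_derive z 1 (fun z => (p + z) / t) t^-1.
  by apply: is_derive_eq; rewrite /GRing.scale/=; ring.
have d2 : is_derive z 1 (fun z => (p - z) / t) (- t^-1).
  by apply: is_derive_eq; rewrite /GRing.scale/=; ring.
have d3 : is_derive z 1 (fun z => t ^+ 2 + (p + z) ^+ 2) (2 * (p + z)).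
  apply: is_derive_eq.
  by rewrite /GRing.scale/=; ring.
have d4 : is_derive z 1 (fun z => t ^+ 2 + (p - z) ^+ 2) (- (2 * (p - z))).
  apply: is_derive_eq.
  by rewrite /GRing.scale/=; ring.
have e1 := @is_derive1_comp R atan (fun z => (p + z) / t) z _ _ (is_derive1_atan _) d1.
have e2 := @is_derive1_comp R atan (fun z => (p - z) / t) z _ _ (is_derive1_atan _) d2.
have e3 := @is_derive1_comp R (@ln R) (fun z => t ^+ 2 + (p + z) ^+ 2) z _ _
  (is_derive1_ln (pos _)) d3.
have e4 := @is_derive1_comp R (@ln R) (fun z => t ^+ 2 + (p - z) ^+ 2) z _ _
  (is_derive1_ln (pos _)) d4.
have e5 := is_deriveB (is_deriveZ ((t ^+ 2 - p ^+ 2) / t) (is_deriveB e1 e2))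
    (is_deriveZ p (is_deriveB e3 e4)).
have e6 := is_deriveZ ((t ^+ 2 + p ^+ 2) ^- 2) e5.
apply: (is_derive_eq e6).
rewrite /GRing.scale/=; field.
rewrite !gt_eqF//=.
Qed.

Lemma kernel_primitive_cvgy {R : realType} (p t : R) : 0 < t ->
  kernel_primitive p t z @[z --> +oo] -->
  (t ^+ 2 + p ^+ 2) ^- 2 * ((t ^+ 2 - p ^+ 2) / t * pi).
Proof.
move=> t0; have -> : (t ^+ 2 - p ^+ 2) / t * pi =
    (t ^+ 2 - p ^+ 2) / t * pi - p * 0 by rewrite mulr0 subr0.
apply: cvgM; first exact: cvg_cst.
apply: cvgB; (apply: cvgM; first exact: cvg_cst).
- exact: atan_affine_cvg.
- exact: ln_affine_cvg.
Qed.

Lemma kernel_primitive_cvg0 {R : realType} (p t : R) : 0 < t ->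
  kernel_primitive p t z @[z --> 0^'+] --> (0 : R).
Proof.
move=> t0.
suff : kernel_primitive p t z @[z --> (0:R)] --> kernel_primitive p t 0.
  rewrite [X in _ --> X -> _]/kernel_primitive subr0 addr0 !subrr !mulr0 subr0.
  by rewrite mulr0; exact: cvg_at_right_filter.
have pos (y : R) : 0 < t ^+ 2 + y ^+ 2 by rewrite ltr_pwDl ?exprn_gt0 ?sqr_ge0.
have cp : (p + z) @[z --> (0:R)] --> p + 0.
  by apply: cvgD; [exact: cvg_cst|exact: cvg_id].
have cm : (p - z) @[z --> (0:R)] --> p - 0.
  by apply: cvgB; [exact: cvg_cst|exact: cvg_id].
have ca (g : R -> R) (l : R) : g z @[z --> (0:R)] --> l ->
    atan (g z / t) @[z --> (0:R)] --> atan (l / t).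
  move=> gl; apply: continuous_cvg; first exact: continuous_atan.
  by apply: cvgM => //; exact: cvg_cst.
have cl (g : R -> R) (l : R) : g z @[z --> (0:R)] --> l ->
    ln (t ^+ 2 + g z ^+ 2) @[z --> (0:R)] --> ln (t ^+ 2 + l ^+ 2).
  move=> gl; apply: continuous_cvg; first exact: continuous_ln.
  apply: cvgD; first exact: cvg_cst.
  exact: (cvgM gl gl).
apply: cvgM; first exact: cvg_cst.
apply: cvgB; (apply: cvgM; first exact: cvg_cst).
- exact: (cvgB (ca (fun z => p + z) _ cp) (ca (fun z => p - z) _ cm)).
- exact: (cvgB (cl (fun z => p + z) _ cp) (cl (fun z => p - z) _ cm)).
Qed.

Lemma heat_kernel_gt0 {R : realType} (x t : R) : 0 < t -> 0 < heat_kernel x t.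
Proof.
move=> t0; rewrite heat_kernelE// !divr_gt0 ?pi_gt0//.
by rewrite ltr_pwDl ?exprn_gt0 ?sqr_ge0.
Qed.

Lemma heat_kernel_le {R : realType} (x t : R) : 0 < t ->
  heat_kernel x t <= t / pi / t ^+ 2.
Proof.
move=> t0; rewrite heat_kernelE// ler_pM2l ?divr_gt0 ?pi_gt0//.
by rewrite lef_pV2 ?posrE ?ltr_pwDl ?exprn_gt0 ?sqr_ge0// lerDl sqr_ge0.
Qed.

Lemma continuous_heat_kernel {R : realType} (a t : R) : 0 < t ->
  continuous (fun y => heat_kernel (y - a) t).
Proof.
move=> t0 y.
have -> : (fun y => heat_kernel (y - a) t) =
    (fun y => t / pi / (t ^+ 2 + (y - a) ^+ 2)).
  by apply/funext => z; rewrite heat_kernelE.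
apply: cvgM; first exact: cvg_cst.
apply: cvgV; first by rewrite gt_eqF// ltr_pwDl ?exprn_gt0 ?sqr_ge0.
apply: cvgD; first exact: cvg_cst.
have h : (z - a) @[z --> y] --> y - a.
  by apply: cvgB; [exact: cvg_id|exact: cvg_cst].
exact: (cvgM h h).
Qed.

Lemma pv_integrand_addl {R : realType} (f : R -> R) (x z : R) :
  pv_integrand f x (x + z) = (f x - f (x + z)) * z ^- 2.
Proof.
by rewrite /pv_integrand opprD addrA subrr add0r normrN real_normK ?num_real.
Qed.

Lemma pv_integrand_subl {R : realType} (f : R -> R) (x z : R) :
  pv_integrand f x (x - z) = (f x - f (x - z)) * z ^- 2.
Proof. by rewrite /pv_integrand subKr real_normK ?num_real. Qed.

(** The value is minus the time derivative of the kernel. After folding, the truncated integral is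
    the limit of [kernel_primitive] at infinity minus its value at [e], up to the factor [t / pi],
    and the latter tends to 0. *)
Lemma half_laplacian_heat_kernel {R : realType} (a x t : R) : 0 < t ->
  is_half_laplacian (fun y => heat_kernel (y - a) t) x
    (pi^-1 * ((t ^+ 2 - (x - a) ^+ 2) / (t ^+ 2 + (x - a) ^+ 2) ^+ 2)).
Proof.
move=> t0; set k := fun y => heat_kernel (y - a) t; set p := x - a.
have pos (y : R) : 0 < t ^+ 2 + y ^+ 2 by rewrite ltr_pwDl ?exprn_gt0 ?sqr_ge0.
have P0 := pi_gt0 R.
set C := t / pi / t ^+ 2.
have C0 : 0 <= C by rewrite !divr_ge0 ?(ltW t0) ?(ltW P0)// exprn_ge0// ltW.
have kC y : `|k x - k y| <= C.
  have := heat_kernel_le (x - a) t0; have := heat_kernel_le (y - a) t0.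
  have := heat_kernel_gt0 (x - a) t0; have := heat_kernel_gt0 (y - a) t0.
  rewrite -/(k x) -/(k y) -/C ler_norml => *; apply/andP; split; lra.
have ck : continuous k by exact: continuous_heat_kernel.
pose f := pv_integrand k x.
have fp z : f (x + z) = (k x - k (x + z)) * z ^- 2 by exact: pv_integrand_addl.
have fm z : f (x - z) = (k x - k (x - z)) * z ^- 2 by exact: pv_integrand_subl.
have intg (g : R -> R) e : 0 < e -> continuous g ->
    (@lebesgue_measure R).-integrable `]e, +oo[
      (EFin \o (fun z => (k x - k (g z)) * z ^- 2)).
  move=> e0 cg; have [i0 _] := ray_inv2 e0.
  have iC : (@lebesgue_measure R).-integrable `]e, +oo[
      (fun z => C%:E * (EFin \o (fun z => z ^- 2)) z)%E by exact: integrableZl.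
  apply: le_integrable iC => //.
    apply/measurable_EFinP; apply: measurable_funM.
      apply: measurable_funTS; apply: continuous_measurable_fun => z.
      apply: cvgB; first exact: cvg_cst.
      by apply: continuous_cvg; [exact: ck|exact: cg].
    by apply/measurable_EFinP; exact: measurable_int i0.
  move=> z _ /=; rewrite lee_fin [X in X <= _]normrM [X in _ <= X]normrM.
  rewrite ler_wpM2r ?normr_ge0//.
  by rewrite (ger0_norm C0).
have pi1 e : 0 < e -> (@lebesgue_measure R).-integrable (pv_domain x e) (EFin \o f).
  move=> e0; rewrite pv_domainE; apply: integrable_shell_inv => //.
  - by move=> z /=; rewrite !in_itv/= !andbT; exact: lt_trans.
  - by rewrite (_ : (fun z => f (x + z)) = fun z => (k x - k (x + z)) * z ^- 2);
      [apply: intg => // z; apply: cvgD; [exact: cvg_cst|exact: cvg_id]|apply/funext].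
  - by rewrite (_ : (fun z => f (x - z)) = fun z => (k x - k (x - z)) * z ^- 2);
      [apply: intg => // z; apply: cvgB; [exact: cvg_cst|exact: cvg_id]|apply/funext].
split => //.
(* The limit of [kernel_primitive p t] at infinity: the arctangents contribute [pi], the logarithms
   nothing. *)
pose L := (t ^+ 2 + p ^+ 2) ^- 2 * ((t ^+ 2 - p ^+ 2) / t * pi).
have val e : 0 < e -> \int[@lebesgue_measure R]_(y in pv_domain x e) f y =
    t / pi * L - t / pi * kernel_primitive p t e.
  move=> e0; have := pi1 _ e0; rewrite pv_domainE => ie.
  rewrite Rintegral_shell//; last first.
    by move=> z /=; rewrite !in_itv/= !andbT; exact: lt_trans.
  have [||||_ ->//] := @ray_FTC R (fun z => f (x + z) + f (x - z))
    (fun z => t / pi * kernel_primitive p t z) (C + C) e (t / pi * L) e0.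
  - move=> z ez; rewrite fp fm -mulrDl normrM [`|z ^- 2|]ger0_norm; last first.
      by rewrite invr_ge0 exprn_ge0// (le_trans (ltW e0)).
    rewrite ler_wpM2r ?invr_ge0 ?exprn_ge0 ?(le_trans (ltW e0))//.
    by rewrite (le_trans (ler_normD _ _))// lerD.
  - move=> z z0.
    rewrite (_ : (fun z => f (x + z) + f (x - z)) = (fun z =>
      (k x - k (x + z)) * z ^- 2 + (k x - k (x - z)) * z ^- 2)); last first.
      by apply/funext => y; rewrite fp fm.
    have cv : (y ^- 2) @[y --> z] --> z ^- 2.
      by apply: cvgV; [rewrite expf_neq0// gt_eqF|exact: exprn_continuous].
    apply: cvgD; apply: cvgM => //; (apply: cvgB; first exact: cvg_cst).
      by apply: continuous_cvg; [exact: ck|apply: cvgD; [exact: cvg_cst|exact: cvg_id]].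
    by apply: continuous_cvg; [exact: ck|apply: cvgB; [exact: cvg_cst|exact: cvg_id]].
  - move=> z z0; have := is_deriveZ (t / pi) (is_derive_kernel_primitive p t0 z0).
    move=> h; apply: (is_derive_eq h).
    rewrite fp fm /k !heat_kernelE// -/p.
    have -> : x + z - a = p + z by rewrite /p; ring.
    have -> : x - z - a = p - z by rewrite /p; ring.
    by rewrite /GRing.scale/=; ring.
  - by apply: cvgM; [exact: cvg_cst|exact: kernel_primitive_cvgy].
have lE : pi^-1 * ((t ^+ 2 - p ^+ 2) / (t ^+ 2 + p ^+ 2) ^+ 2) =
    pi^-1 * (t / pi * L - t / pi * 0).
  rewrite /L; move: (pi : R) P0 => P P0; field.
  by rewrite !gt_eqF.
rewrite lE.
have : pi^-1 * (t / pi * L - t / pi * kernel_primitive p t e) @[e --> 0^'+] -->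
    pi^-1 * (t / pi * L - t / pi * 0).
  apply: cvgM; first exact: cvg_cst.
  apply: cvgB; first exact: cvg_cst.
  by apply: cvgM; [exact: cvg_cst|exact: kernel_primitive_cvg0].
apply: cvg_trans; apply: near_eq_cvg; near=> e.
by rewrite val//; near: e; exact: nbhs_right_gt.
Unshelve. all: by end_near. Qed.

(** * Linearity of the half-Laplacian and of the equation at a point *)

Lemma measurable_pv_domain {R : realType} (x e : R) : measurable (pv_domain x e).
Proof. by rewrite pv_domainE; exact: measurable_shell. Qed.

Lemma is_half_laplacian_cst {R : realType} (c x : R) :
  is_half_laplacian (fun=> c) x 0.
Proof.
have E : pv_integrand (fun=> c) x = fun=> 0.
  by apply/funext => y; rewrite /pv_integrand subrr mul0r.
split; rewrite E; first move=> e e0.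
  by rewrite (_ : EFin \o _ = cst 0%E)//; exact: integrable0.
rewrite -[X in _ --> X](mulr0 pi^-1); apply: cvgM; first exact: cvg_cst.
rewrite (_ : (fun e => _) = fun=> 0); first exact: cvg_cst.
apply/funext => e; rewrite Rintegral_cst ?mul0r//; exact: measurable_pv_domain.
Qed.

Lemma is_half_laplacianD {R : realType} (f g : R -> R) (x l m : R) :
  is_half_laplacian f x l -> is_half_laplacian g x m ->
  is_half_laplacian (fun y => f y + g y) x (l + m).
Proof.
move=> [fi fl] [gi gl].
have E : pv_integrand (fun y => f y + g y) x =
    fun y => pv_integrand f x y + pv_integrand g x y.
  by apply/funext => y; rewrite /pv_integrand -mulrDl; congr (_ / _); ring.
split; rewrite E.
  move=> e e0; rewrite (_ : EFin \o _ =
    ((EFin \o pv_integrand f x) \+ (EFin \o pv_integrand g x))%E)//.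
  by apply: integrableD; [exact: measurable_pv_domain|exact: fi|exact: gi].
apply: cvg_trans (cvgD fl gl); apply: near_eq_cvg; near=> e.
have e0 : 0 < e by near: e; exact: nbhs_right_gt.
rewrite -mulrDr RintegralD//; [exact: measurable_pv_domain|exact: fi|exact: gi].
Unshelve. all: by end_near. Qed.

Lemma is_half_laplacianZ {R : realType} (c : R) (f : R -> R) (x l : R) :
  is_half_laplacian f x l -> is_half_laplacian (fun y => c * f y) x (c * l).
Proof.
move=> [fi fl].
have E : pv_integrand (fun y => c * f y) x = fun y => c * pv_integrand f x y.
  by apply/funext => y; rewrite /pv_integrand mulrA; congr (_ / _); ring.
split; rewrite E.
  move=> e e0; rewrite (_ : EFin \o _ =
    (fun y => c%:E * (EFin \o pv_integrand f x) y)%E)//.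
  by apply: integrableZl; [exact: measurable_pv_domain|exact: fi].
apply: cvg_trans (cvgM (cvg_cst c) fl); apply: near_eq_cvg; near=> e.
have e0 : 0 < e by near: e; exact: nbhs_right_gt.
rewrite RintegralZl//; [|exact: measurable_pv_domain|exact: fi].
by rewrite mulrCA.
Unshelve. all: by end_near. Qed.

(** The equation at one point, with differentiability in time included and no sign condition, so
    that it passes to differences of solutions. *)
Definition solves {R : realType} (v : R -> R -> R) (x t : R) : Prop :=
  exists2 l, is_half_laplacian (v^~ t) x l & is_derive t 1 (v x) (- l).

Lemma solves_cst {R : realType} (c x t : R) : solves (fun _ _ => c) x t.
Proof.
exists 0; first exact: is_half_laplacian_cst.
by rewrite oppr0; exact: is_derive_cst.
Qed.

Lemma solvesD {R : realType} (v w : R -> R -> R) (x t : R) :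
  solves v x t -> solves w x t -> solves (fun x t => v x t + w x t) x t.
Proof.
move=> [l hv dv] [m hw dw]; exists (l + m); first exact: is_half_laplacianD.
by rewrite opprD; exact: is_deriveD.
Qed.

Lemma solvesZ {R : realType} (c : R) (v : R -> R -> R) (x t : R) :
  solves v x t -> solves (fun x t => c * v x t) x t.
Proof.
move=> [l hv dv]; exists (c * l); first exact: is_half_laplacianZ.
by rewrite -mulrN; exact: is_deriveZ.
Qed.

Lemma solves_heat_kernel {R : realType} (a x s t : R) : 0 < t + s ->
  solves (fun x t => heat_kernel (x - a) (t + s)) x t.
Proof.
move=> ts; exists (pi^-1 * (((t + s) ^+ 2 - (x - a) ^+ 2) /
    ((t + s) ^+ 2 + (x - a) ^+ 2) ^+ 2)); first exact: half_laplacian_heat_kernel.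
set p := x - a.
have pos : 0 < (t + s) ^+ 2 + p ^+ 2 by rewrite ltr_pwDl ?exprn_gt0 ?sqr_ge0.
have d1 : is_derive t 1 (fun t : R => (t + s) / pi) pi^-1.
  by apply: is_derive_eq; rewrite /GRing.scale/=; ring.
have d2 : is_derive t 1 (fun t : R => ((t + s) ^+ 2 + p ^+ 2)^-1)
    (- (2 * (t + s)) / ((t + s) ^+ 2 + p ^+ 2) ^+ 2).
  have d3 : is_derive t 1 (fun t : R => (t + s) ^+ 2 + p ^+ 2) (2 * (t + s)).
    by apply: is_derive_eq; rewrite /GRing.scale/=; ring.
  have n0 : (t + s) ^+ 2 + p ^+ 2 != 0 by rewrite gt_eqF.
  apply: (is_derive_eq (@is_deriveV R (fun t => (t + s) ^+ 2 + p ^+ 2)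
    t _ 1 n0 d3)).
  by rewrite /GRing.scale/=; field.
apply: (@near_eq_is_derive _ _ _ (fun t => (t + s) / pi * ((t + s) ^+ 2 + p ^+ 2)^-1)).
- near=> u; rewrite heat_kernelE//.
  suff : - s < u by lra.
  by near: u; apply: lt_nbhsr; lra.
- apply: (is_derive_eq (is_deriveM d1 d2)).
  rewrite /GRing.scale/=; have := pi_gt0 R; move: (pi : R) => P P0; field.
  by rewrite !gt_eqF.
Unshelve. all: by end_near. Qed.

(** * Superpositions of heat kernels *)

(** The Poisson extension of a discrete measure: each pair is a weight and a centre. *)
Definition kernel_sum {R : realType} (s : seq (R * R)) (x t : R) : R :=
  \sum_(p <- s) p.1 * heat_kernel (x - p.2) t.

Lemma solves_kernel_sum {R : realType} (s : seq (R * R)) (x r t : R) :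
  0 < t + r -> solves (fun x t => kernel_sum s x (t + r)) x t.
Proof.
move=> tr; elim: s => [|p s IH].
  rewrite (_ : (fun _ _ => _) = fun _ _ => 0); first exact: solves_cst.
  by apply/funext => y; apply/funext => u; rewrite /kernel_sum big_nil.
rewrite (_ : (fun _ _ => _) = fun x t =>
    p.1 * heat_kernel (x - p.2) (t + r) + kernel_sum s x (t + r)).
  apply: solvesD => //; apply: (@solvesZ _ _ (fun x t => heat_kernel (x - p.2) (t + r))).
  exact: solves_heat_kernel.
by apply/funext => y; apply/funext => u; rewrite /kernel_sum big_cons.
Qed.

Lemma kernel_sum_ge0 {R : realType} (s : seq (R * R)) (x t : R) : 0 < t ->
  all (fun p => 0 <= p.1) s -> 0 <= kernel_sum s x t.
Proof.
move=> t0 /allP s0; rewrite /kernel_sum big_seq sumr_ge0// => p ps.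
by rewrite mulr_ge0 ?s0// ltW// heat_kernel_gt0.
Qed.

Lemma continuous_kernel_sum {R : realType} (s : seq (R * R)) (r : R)
    (q : R * R) : 0 < q.2 + r ->
  {for q, continuous (fun p : R * R => kernel_sum s p.1 (p.2 + r))}.
Proof.
move=> qr; elim: s => [|p s IH].
  rewrite (_ : (fun _ => _) = fun=> 0); first exact: cvg_cst.
  by apply/funext => y; rewrite /kernel_sum big_nil.
rewrite (_ : (fun _ => _) = fun q =>
    p.1 * heat_kernel (q.1 - p.2) (q.2 + r) + kernel_sum s q.1 (q.2 + r)); last first.
  by apply/funext => y; rewrite /kernel_sum big_cons.
apply: cvgD; last exact: IH.
apply: cvgM; first exact: cvg_cst.
have c1 : (q'.1 - p.2) @[q' --> q] --> q.1 - p.2.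
  by apply: cvgB; [exact: cvg_fst|exact: cvg_cst].
have c2 : (q'.2 + r) @[q' --> q] --> q.2 + r.
  by apply: cvgD; [exact: cvg_snd|exact: cvg_cst].
have c3 : (pi * (q'.2 + r)) @[q' --> q] --> pi * (q.2 + r).
  by apply: cvgM; first exact: cvg_cst.
have c4 : ((q'.2 + r) ^+ 2) @[q' --> q] --> (q.2 + r) ^+ 2 by exact: (cvgM c2 c2).
have c5 : (`|q'.1 - p.2|) @[q' --> q] --> `|q.1 - p.2| by exact: cvg_norm.
have c6 : (`|q'.1 - p.2| ^+ 2) @[q' --> q] --> `|q.1 - p.2| ^+ 2 by exact: (cvgM c5 c5).
have n0 : (q.2 + r) ^+ 2 != 0 by rewrite expf_neq0// gt_eqF.
apply: cvgM; apply: cvgM; (try exact: cvg_cst).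
  by apply: cvgV => //; rewrite mulf_neq0// gt_eqF// pi_gt0.
apply: cvgV; first by rewrite gt_eqF// ltr_pwDl// divr_ge0// exprn_ge0// ltW.
apply: cvgD; first exact: cvg_cst.
by apply: cvgM => //; apply: cvgV.
Qed.

Lemma kernel_sum_decay {R : realType} (s : seq (R * R)) (T eta : R) :
  0 < T -> 0 < eta -> all (fun p => 0 <= p.1) s ->
  exists X : R, forall x t, X <= `|x| -> 0 < t -> t <= T -> kernel_sum s x t <= eta.
Proof.
move=> T0; elim: s eta => [|p s IH] eta eta0.
  by move=> _; exists 0 => x t _ _ _; rewrite /kernel_sum big_nil ltW.
move=> /= /andP[p0 s0].
have e2 : 0 < eta / 2 by rewrite divr_gt0.
have [X HX] := IH _ e2 s0.
(* At distance at least [Y] from the centre the kernel is at most [T / Y] for every age up to [T],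
   because [Y <= Y ^+ 2]; the second summand then gives [p.1 * T / Y <= eta / 2]. *)
pose Y := 1 + p.1 * T / (eta / 2).
have Y1 : 1 <= Y.
  by rewrite /Y lerDl; apply: divr_ge0; [apply: mulr_ge0 => //; exact: ltW|exact: ltW].
exists (Num.max X (`|p.2| + Y)) => x t; rewrite ge_max => /andP[Xx Yx] t0 tT.
rewrite /kernel_sum big_cons [leRHS]splitr lerD//; last exact: HX.
have Yd : Y <= `|x - p.2|.
  have := ler_normD (x - p.2) p.2; rewrite subrK; lra.
have d0 : 0 < `|x - p.2| by rewrite (lt_le_trans _ Yd)// (lt_le_trans _ Y1).
have Y2 : Y <= (x - p.2) ^+ 2.
  have -> : (x - p.2) ^+ 2 = `|x - p.2| ^+ 2 by rewrite real_normK ?num_real.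
  by rewrite (le_trans Yd)// expr2 ler_peMl// ?normr_ge0// (le_trans Y1).
have h : heat_kernel (x - p.2) t <= T / Y.
  rewrite heat_kernelE//; apply: ler_pM.
  - by rewrite divr_ge0 ?pi_ge0// ltW.
  - by rewrite invr_ge0 addr_ge0// sqr_ge0.
  - rewrite ler_pdivrMr ?pi_gt0//; have := pi_ge2 R; nra.
  - rewrite lef_pV2 ?posrE; [|by rewrite ltr_pwDl ?exprn_gt0 ?sqr_ge0|lra].
    by rewrite (le_trans Y2)// lerDr sqr_ge0.
apply: (le_trans (ler_wpM2l p0 h)).
rewrite mulrA ler_pdivrMr; last by lra.
rewrite /Y mulrDr mulr1 [X in _ + X]mulrCA mulfV ?gt_eqF// mulr1.
by rewrite lerDr ltW.
Qed.

(** * Uniform approximation of compactly supported functions by superpositions *)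

Lemma compact_support_unif {R : realType} (f : R -> R) (a b eta : R) :
  continuous f -> (forall x, x \notin `[a, b]%R -> f x = 0) -> 0 < eta ->
  exists2 rho, 0 < rho & forall x y, `|x - y| <= rho -> `|f x - f y| <= eta.
Proof.
move=> cf f0 eta0.
have [rho rho0 H] : exists2 rho, 0 < rho & forall x, x \in `[a, b]%R ->
    forall y, `|x - y| <= rho -> `|f x - f y| <= eta.
  (* Compactness yields one radius for all [x] in the segment and arbitrary [y]; the remaining pairs
     have both points outside, where [f] vanishes. *)
  have /compact_near_coveringP K := @segment_compact R a b.
  have H : \forall rho \near 0^'+, `[a, b]%classic `<=`
      (fun x => forall y, `|x - y| <= rho -> `|f x - f y| <= eta).
    apply: K => x _.
    have e2 : 0 < eta / 2 by rewrite divr_gt0.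
    have /cvgrPdist_le /(_ _ e2) /nbhs_ballP[d /= d0 dH] := cf x.
    have d2 : 0 < d / 2 by rewrite divr_gt0.
    near=> x' r => y x'y.
    have xx' : `|x - x'| < d / 2 by near: x'; exact: nbhsx_ballx.
    have rd : r < d / 2 by near: r; exact: nbhs_right_lt.
    have h1 : `|f x - f x'| <= eta / 2.
      by apply: dH; rewrite /ball/= (lt_trans xx')//; lra.
    have h2 : `|f x - f y| <= eta / 2.
      apply: dH; rewrite /ball/=.
      apply: (le_lt_trans (ler_distD x' x y)).
      by rewrite [ltRHS]splitr; apply: ltrD => //; exact: le_lt_trans x'y rd.
    apply: (le_trans (ler_distD (f x) (f x') (f y))).
    by rewrite [leRHS]splitr lerD// distrC.
  have [rho [Hr r0]] := filter_ex (filterI H (nbhs_right_gt (0:R))).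
  by exists rho.
exists rho => // x y xy.
have [xK|xK] := boolP (x \in `[a, b]%R); first exact: H.
have [yK|yK] := boolP (y \in `[a, b]%R); first by rewrite distrC H// distrC.
by rewrite !f0// subrr normr0 ltW.
Unshelve. all: by end_near. Qed.

(** Once [q - p] and the constant are factored out, the remaining quotient is at most 1 in absolute
    value, by the inequality [t * |p| <= (t ^+ 2 + p ^+ 2) / 2] and its analogue for [q]. *)
Lemma heat_kernel_lipschitz {R : realType} (p q t : R) : 0 < t ->
  `|heat_kernel p t - heat_kernel q t| <= (pi * t ^+ 2)^-1 * `|p - q|.
Proof.
move=> t0; rewrite !heat_kernelE//.
have pos (y : R) : 0 < t ^+ 2 + y ^+ 2 by rewrite ltr_pwDl ?exprn_gt0 ?sqr_ge0.
have P0 := pi_gt0 R.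
have -> : t / pi / (t ^+ 2 + p ^+ 2) - t / pi / (t ^+ 2 + q ^+ 2) =
    (pi * t ^+ 2)^-1 * ((q - p) * (t ^+ 3 * (p + q) /
       ((t ^+ 2 + p ^+ 2) * (t ^+ 2 + q ^+ 2)))).
  by move: (pi : R) P0 => P P0; field; rewrite !gt_eqF.
rewrite normrM ger0_norm ?invr_ge0 ?mulr_ge0 ?exprn_ge0 ?(ltW P0) ?(ltW t0)//.
rewrite ler_pM2l ?invr_gt0 ?mulr_gt0 ?exprn_gt0// normrM distrC.
rewrite ler_piMr ?normr_ge0// normrM normfV [X in _ / X]gtr0_norm ?mulr_gt0//.
rewrite ler_pdivrMr ?mulr_gt0// mul1r normrM gtr0_norm ?exprn_gt0//.
have hp : t * `|p| <= (t ^+ 2 + p ^+ 2) / 2.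
  have -> : p ^+ 2 = `|p| ^+ 2 by rewrite real_normK ?num_real.
  by have := sqr_ge0 (t - `|p|); lra.
have hq : t * `|q| <= (t ^+ 2 + q ^+ 2) / 2.
  have -> : q ^+ 2 = `|q| ^+ 2 by rewrite real_normK ?num_real.
  by have := sqr_ge0 (t - `|q|); lra.
apply: (@le_trans _ _ (t ^+ 2 * (t * `|p| + t * `|q|))).
  by rewrite -mulrDr mulrA -exprSr ler_pM2l ?exprn_gt0// ler_normD.
have p2 := sqr_ge0 p; have q2 := sqr_ge0 q; have t2 : 0 < t ^+ 2 by rewrite exprn_gt0.
move: hp hq; move: (t * `|p|) (t * `|q|) => u v hp hq.
have h : u + v <= t ^+ 2 + p ^+ 2 / 2 + q ^+ 2 / 2 by lra.
by rewrite (le_trans (ler_wpM2l (ltW t2) h))//; nra.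
Qed.

Lemma heat_kernelN {R : realType} (x t : R) : heat_kernel (- x) t = heat_kernel x t.
Proof. by rewrite /heat_kernel normrN. Qed.

Lemma is_derive_atan_heat_kernel {R : realType} (a t y : R) : 0 < t ->
  is_derive y 1 (fun y => atan ((y - a) / t) / pi) (heat_kernel (y - a) t).
Proof.
move=> t0.
have d1 : is_derive y 1 (fun y => (y - a) / t) t^-1.
  by apply: is_derive_eq; rewrite /GRing.scale/=; ring.
have d2 := @is_derive1_comp R atan (fun y => (y - a) / t) y _ _ (is_derive1_atan _) d1.
have d3 := is_deriveM d2 (is_derive_cst (pi^-1 : R) y 1).
apply: (is_derive_eq d3); rewrite /GRing.scale/= heat_kernelE//.
have pos : 0 < t ^+ 2 + (y - a) ^+ 2 by rewrite ltr_pwDl ?exprn_gt0 ?sqr_ge0.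
have := pi_gt0 R; move: (pi : R) => P P0; field.
by rewrite !gt_eqF.
Qed.

(** The left side is the kernel mass of the cell from [z] to [z + h]. The mean value theorem lets
    Riemann sums be compared with exact masses, which telescope, without any integral. *)
Lemma heat_kernel_cell {R : realType} (x z h t : R) : 0 < t -> 0 < h ->
  exists2 xi, z < xi < z + h &
  (atan ((z + h - x) / t) - atan ((z - x) / t)) / pi = h * heat_kernel (x - xi) t.
Proof.
move=> t0 h0; pose g y := atan ((y - x) / t) / pi.
have dg (y : R) : is_derive y 1 g (heat_kernel (x - y) t).
  by rewrite -opprB heat_kernelN; exact: is_derive_atan_heat_kernel.
have [||xi] := @MVT R g (fun y => heat_kernel (x - y) t) z (z + h).
- by rewrite ltrDl.
- apply: continuous_subspaceT => y; apply/differentiable_continuous/derivable1_diffP.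
  by case: (dg y).
rewrite in_itv/= => zxi E; exists xi => //.
by rewrite mulrBl -/(g (z + h)) -/(g z) E mulrC; congr (_ * _); ring.
Qed.

Lemma atan_near_pihalf {R : realType} (th : R) : 0 < th ->
  exists2 A, 0 < A & forall y, A <= y -> pi / 2 - th <= atan y.
Proof.
move=> th0; have /cvgrPdist_le /(_ _ th0) [A [Ar HA]] := @cvgy_atan R.
exists (`|A| + 1) => [|y Ay]; first by rewrite ltr_pwDr.
have /HA : A < y by apply: lt_le_trans Ay; rewrite ltr_pwDr// ler_norm.
by rewrite ler_norml => /andP[_]; lra.
Qed.

(** A Riemann sum for the convolution of [f] with the kernel of small age. The error has three
    sources: the kernel at a node against its mean on the cell, [f] at a node against [f x], and the
    kernel mass lying outside the interval. They cost [e4], [2 * e4] and [e4]. *)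
Lemma kernel_sum_approx {R : realType} (f : R -> R) (a b eta eps0 : R) :
  a < b -> continuous f -> (forall x, 0 <= f x) ->
  (forall x, x \notin `]a, b[%R -> f x = 0) -> 0 < eta -> 0 < eps0 ->
  exists eps (s : seq (R * R)), [/\ 0 < eps < eps0, all (fun p => 0 <= p.1) s,
    all (fun p => a <= p.2 <= b) s & forall x, `|kernel_sum s x eps - f x| <= eta].
Proof.
move=> ab cf f0 fs eta0 eps00.
pose e4 := eta / 4; have e40 : 0 < e4 by rewrite /e4; lra.
have [rho rho0 Hrho] : exists2 rho, 0 < rho &
    forall x y, `|x - y| <= rho -> `|f x - f y| <= e4.
  apply: (@compact_support_unif _ _ a b) => // x xab; apply: fs.
  by apply: contra xab; rewrite !in_itv/= => /andP[/ltW -> /ltW ->].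
have [M M0 fM] : exists2 M, 0 < M & forall x, f x <= M.
  have [c _ Hc] := EVT_max (ltW ab) (continuous_subspaceT cf).
  exists (f c + 1) => [|x]; first by rewrite ltr_wpDl.
  have [xab|xab] := boolP (x \in `[a, b]%R).
    by rewrite (le_trans (Hc x xab))// lerDl.
  rewrite fs ?addr_ge0//; apply: contra xab.
  by rewrite !in_itv/= => /andP[/ltW -> /ltW ->].
have [A A0 HA] := atan_near_pihalf (divr_gt0 e40 M0).
have ba0 : 0 < b - a by rewrite subr_gt0.
have P0 := pi_gt0 R; have P2 := pi_ge2 R.
(* The second entry puts [atan (rho / eps)] within [e4 / M] of [pi / 2]; the third makes the
   contribution of nodes farther than [rho] at most [e4]. *)
pose eps := Num.min (eps0 / 2) (Num.min (rho / A) (e4 * rho ^+ 2 / (2 * M * (b - a)))).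
have epsgt0 : 0 < eps.
  by rewrite /eps !lt_min !divr_gt0// ?mulr_gt0// ?exprn_gt0.
have eps1 : eps < eps0.
  by apply: (@le_lt_trans _ _ (eps0 / 2)); [rewrite ge_min lexx|lra].
have eps2 : eps <= rho / A by rewrite !ge_min lexx orbT.
have eps3 : eps <= e4 * rho ^+ 2 / (2 * M * (b - a)).
  by rewrite !ge_min lexx !orbT.
clearbody eps.
pose L := (pi * eps ^+ 2)^-1.
have L0 : 0 < L by rewrite invr_gt0 mulr_gt0// exprn_gt0.
(* With more than [y] cells the mesh satisfies [h <= rho / 2] and [M * (b - a) * L * h <= e4], where
   [L] is the Lipschitz constant of the kernel of age [eps]. *)
pose y := Num.max ((b - a) / (rho / 2)) ((b - a) * (M * (b - a) * L) / e4).
have y0 : 0 <= y by rewrite /y le_max divr_ge0// ltW// divr_gt0.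
pose n := Num.bound y.
have yn : y < n%:R by exact: archi_boundP.
have n0 : 0 < n%:R :> R by exact: le_lt_trans yn.
pose h := (b - a) / n%:R.
have h0 : 0 < h by rewrite divr_gt0.
have nh : n%:R * h = b - a by rewrite mulrC divfK// gt_eqF.
have h1 : h <= rho / 2.
  rewrite ler_pdivrMr// mulrC -ler_pdivrMr ?divr_gt0//.
  by apply: ltW; apply: le_lt_trans yn; rewrite le_max lexx.
have h2 : M * (b - a) * L * h <= e4.
  rewrite /h mulrA ler_pdivrMr// mulrC [e4 * _]mulrC -ler_pdivrMr//.
  by apply: ltW; apply: le_lt_trans yn; rewrite le_max lexx orbT.
pose z (i : nat) := a + i%:R * h.
have zS i : z i.+1 = z i + h by rewrite /z -natr1; ring.
have zn : z n = b by rewrite /z nh; ring.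
pose s := [seq (h * f (z i), z i) | i <- iota 0 n].
exists eps, s; split.
- by rewrite epsgt0.
- by apply/allP => _ /mapP[i _ ->] /=; rewrite mulr_ge0// ltW.
- apply/allP => _ /mapP[i + ->] /=; rewrite mem_iota add0n => /andP[_ ni].
  rewrite /z lerDl mulr_ge0 ?(ltW h0)//= -lerBrDl -nh ler_pM2r//.
  by rewrite ler_nat ltnW.
move=> x.
pose k i := heat_kernel (x - z i) eps.
pose I i := (atan ((z i + h - x) / eps) - atan ((z i - x) / eps)) / pi.
have sE : kernel_sum s x eps = \sum_(0 <= i < n) (h * f (z i)) * k i.
  by rewrite /kernel_sum big_map /index_iota subn0.
have SI : \sum_(0 <= i < n) I i = (atan ((b - x) / eps) - atan ((a - x) / eps)) / pi.
  rewrite -mulr_suml; congr (_ / _).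
  under eq_bigr do rewrite -zS.
  rewrite (telescope_sumr (fun i => atan ((z i - x) / eps)))//.
  by rewrite zn /z mul0r addr0.
have SI1 : \sum_(0 <= i < n) I i <= 1.
  rewrite SI ler_pdivrMr// mul1r.
  by have := atan_ltpi2 ((b - x) / eps); have := atan_gtNpi2 ((a - x) / eps); lra.
have cell i : exists2 xi, z i < xi < z i + h & I i = h * heat_kernel (x - xi) eps.
  exact: heat_kernel_cell.
have I0 i : 0 <= I i.
  by have [xi _ ->] := cell i; rewrite mulr_ge0 ?(ltW h0)// ltW// heat_kernel_gt0.
have SI0 : 0 <= \sum_(0 <= i < n) I i by apply: sumr_ge0.
have B1 i : `|f (z i) * (h * k i - I i)| <= M * (h * (L * h)).
  have [xi xi1 ->] := cell i.
  rewrite normrM ler_pM ?normr_ge0//; first by rewrite ger0_norm.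
  rewrite -mulrBr normrM gtr0_norm// ler_pM2l//.
  apply: (le_trans (heat_kernel_lipschitz _ _ epsgt0)); rewrite -/L ler_pM2l//.
  by move: xi1; rewrite ler_norml; lra.
have B2 i : `|(f (z i) - f x) * I i| <= e4 * I i + M * (h * (2 * eps / rho ^+ 2)).
  have q0 : 0 <= M * (h * (2 * eps / rho ^+ 2)).
    have q1 : 0 <= 2 * eps / rho ^+ 2 by apply: divr_ge0; [lra|exact: sqr_ge0].
    by apply: mulr_ge0; [exact: ltW|apply: mulr_ge0; [exact: ltW|]].
  rewrite normrM [`|I i|]ger0_norm//.
  have [zx|zx] := lerP `|z i - x| rho.
    by apply: ler_wpDr => //; rewrite ler_wpM2r// Hrho.
  apply: ler_wpDl; first by rewrite mulr_ge0// ltW.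
  rewrite ler_pM ?normr_ge0//.
    by rewrite ler_norml; have := fM (z i); have := fM x; have := f0 (z i);
      have := f0 x; lra.
  have [xi xi1 ->] := cell i.
  rewrite ler_pM2l// heat_kernelE//.
  (* The node is farther than [rho] from [x] and [xi] is within [h <= rho / 2] of the node. Below,
     [pi >= 2] replaces [eps / pi] by [eps / 2]. *)
  have d1 : rho / 2 <= `|x - xi|.
    have := ler_distD xi (z i) x; rewrite [`|xi - x|]distrC.
    have : `|z i - xi| <= h by rewrite ler_norml; lra.
    lra.
  have d2 : (rho / 2) ^+ 2 <= (x - xi) ^+ 2.
    have -> : (x - xi) ^+ 2 = `|x - xi| ^+ 2 by rewrite real_normK ?num_real.
    by rewrite lerXn2r ?nnegrE// ltW// divr_gt0.
  have d3 : 0 < (rho / 2) ^+ 2 by rewrite exprn_gt0// divr_gt0.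
  have -> : 2 * eps / rho ^+ 2 = eps / 2 / (rho / 2) ^+ 2.
    by field; rewrite gt_eqF.
  apply: ler_pM.
  - by rewrite divr_ge0// ltW.
  - by rewrite invr_ge0 addr_ge0 ?sqr_ge0.
  - by rewrite ler_pM2l// lef_pV2 ?posrE.
  - rewrite lef_pV2 ?posrE//; last by rewrite ltr_pwDl ?exprn_gt0 ?sqr_ge0.
    by rewrite (le_trans d2)// lerDr sqr_ge0.
(* Either [f x] itself is small, or [x] is farther than [rho] from both ends, where [f] vanishes,
   and then nearly all the kernel mass lies inside the interval. *)
have B3 : `|f x * (\sum_(0 <= i < n) I i - 1)| <= e4.
  rewrite normrM ger0_norm// ler0_norm ?subr_le0// opprB.
  have [fx|fx] := lerP (f x) e4.
    by rewrite -[leRHS]mulr1 ler_pM ?subr_ge0//; lra.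
  have outside u : u \notin `]a, b[%R -> rho < `|x - u|.
    move=> uab; rewrite ltNge; apply/negP => /Hrho; rewrite (fs u uab) subr0.
    by rewrite ger0_norm//; lra.
  have xab : x \in `]a, b[%R.
    by apply: contraTT fx => /fs ->; rewrite -leNgt ltW.
  have xa : rho < x - a.
    have := outside a; rewrite in_itv/= ltxx => /(_ isT).
    by rewrite gtr0_norm//; move: xab; rewrite in_itv/=; lra.
  have xb : rho < b - x.
    have := outside b; rewrite in_itv/= ltxx andbF => /(_ isT).
    by rewrite distrC gtr0_norm//; move: xab; rewrite in_itv/=; lra.
  have big u : rho < u -> pi / 2 - e4 / M <= atan (u / eps).
    move=> ru; apply: HA; rewrite ler_pdivlMr// mulrC -ler_pdivlMr//.
    by rewrite (le_trans eps2)// ler_pM2r ?invr_gt0// ltW.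
  have m1 := big _ xb; have := big _ xa.
  rewrite -[x - a]opprB mulNr atanN => m2.
  have m3 : 1 - \sum_(0 <= i < n) I i <= e4 / M.
    rewrite lerBlDl -lerBlDr SI ler_pdivlMr//.
    have em : 0 < e4 / M by rewrite divr_gt0.
    move: em m1 m2; move: (e4 / M) => q; nra.
  apply: (le_trans (ler_pM (f0 x) _ (fM x) m3)); first by rewrite subr_ge0.
  by rewrite mulrC divfK// gt_eqF.
have -> : kernel_sum s x eps - f x =
    \sum_(0 <= i < n) (f (z i) * (h * k i - I i)) +
    \sum_(0 <= i < n) ((f (z i) - f x) * I i) +
    f x * (\sum_(0 <= i < n) I i - 1).
  rewrite sE mulrBr mulr1 mulr_sumr addrA -!big_split/=; congr (_ - _).
  by apply: eq_bigr => i _; ring.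
have S1 : `|\sum_(0 <= i < n) (f (z i) * (h * k i - I i))| <= e4.
  apply: (le_trans (ler_norm_sum _ _ _)).
  apply: (@le_trans _ _ (\sum_(0 <= i < n) (M * (h * (L * h))))).
    by apply: ler_sum => i _; exact: B1.
  rewrite sumr_const_nat subn0 -mulr_natl; apply: le_trans h2.
  by rewrite -nh le_eqVlt; apply/orP; left; apply/eqP; ring.
have S2 : `|\sum_(0 <= i < n) ((f (z i) - f x) * I i)| <= e4 + e4.
  apply: (le_trans (ler_norm_sum _ _ _)).
  apply: (@le_trans _ _ (\sum_(0 <= i < n) (e4 * I i + M * (h * (2 * eps / rho ^+ 2))))).
    by apply: ler_sum => i _; exact: B2.
  rewrite big_split/= -mulr_sumr sumr_const_nat subn0 -mulr_natl lerD//.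
    by rewrite -[leRHS]mulr1 ler_pM2l.
  rewrite [leLHS](_ : _ = (2 * M * (b - a)) * eps / rho ^+ 2); last first.
    by rewrite -nh; ring.
  rewrite ler_pdivrMr ?exprn_gt0// mulrC -ler_pdivlMr// !mulr_gt0//.
have := ler_normD (\sum_(0 <= i < n) (f (z i) * (h * k i - I i)) +
    \sum_(0 <= i < n) ((f (z i) - f x) * I i)) (f x * (\sum_(0 <= i < n) I i - 1)).
have := ler_normD (\sum_(0 <= i < n) (f (z i) * (h * k i - I i)))
    (\sum_(0 <= i < n) ((f (z i) - f x) * I i)).
by rewrite /e4 in S1 S2 B3 *; lra.
Qed.

(** * Maximum principle *)

(** Only earlier times are used, because the extrema below may occur at the final time of the
    box. *)
Lemma derive_le_left {R : realType} (g : R -> R) (s t l b : R) : s < t ->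
  is_derive t 1 g l ->
  (forall u, s <= u -> u < t -> g t - g u <= b * (t - u)) -> l <= b.
Proof.
move=> st [dg gl] H.
have c : h^-1 *: ((g \o shift t) (h *: 1) - g t) @[h --> 0^'] --> l.
  by rewrite -gl; exact: dg.
apply: (cvgr_to_le (cvg_dnbhs_at_left c)); near=> h.
have h0 : h < 0 by near: h; exact: nbhs_left_lt.
have hs : s - t <= h.
  apply: ltW; near: h; apply: nbhs_left_gt; rewrite subr_lt0.
  exact: st.
have := H (h + t); rewrite -lerBlDr => /(_ hs).
have ht : h + t < t by rewrite gtrDr.
move=> /(_ ht); rewrite opprD addrCA subrr addr0 => Hh.
rewrite /GRing.scale/= mulr1 mulrC ler_ndivrMr//; lra.
Unshelve. all: by end_near. Qed.

Lemma derive_ge_left {R : realType} (g : R -> R) (s t l b : R) : s < t ->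
  is_derive t 1 g l ->
  (forall u, s <= u -> u < t -> b * (t - u) <= g t - g u) -> b <= l.
Proof.
move=> st dg H; rewrite -lerN2.
apply: (@derive_le_left _ (fun t => - g t) s t _ _ st).
by move=> u su ut; have := H u su ut; lra.
Qed.

Lemma half_laplacian_le {R : realType} (f : R -> R) (x l r A : R) : 0 < r ->
  is_half_laplacian f x l ->
  (forall e, 0 < e -> e < r ->
    \int[lebesgue_measure]_(y in pv_domain x e) pv_integrand f x y <= A) ->
  l <= pi^-1 * A.
Proof.
move=> r0 [_ fl] H; apply: (cvgr_to_le fl); near=> e.
rewrite ler_pM2l ?invr_gt0 ?pi_gt0//; apply: H.
  by near: e; exact: nbhs_right_gt.
by near: e; exact: nbhs_right_lt.
Unshelve. all: by end_near. Qed.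

Lemma half_laplacian_ge {R : realType} (f : R -> R) (x l r A : R) : 0 < r ->
  is_half_laplacian f x l ->
  (forall e, 0 < e -> e < r ->
    A <= \int[lebesgue_measure]_(y in pv_domain x e) pv_integrand f x y) ->
  pi^-1 * A <= l.
Proof.
move=> r0 [_ fl] H; apply: (cvgr_to_ge fl); near=> e.
rewrite ler_pM2l ?invr_gt0 ?pi_gt0//; apply: H.
  by near: e; exact: nbhs_right_gt.
by near: e; exact: nbhs_right_lt.
Unshelve. all: by end_near. Qed.

Definition box {R : realType} (X s t : R) : set (R * R) :=
  `[- X, X]%classic `*` `[s, t]%classic.

Lemma compact_box {R : realType} (X s t : R) : compact (box X s t).
Proof. by apply: compact_setX; exact: segment_compact. Qed.

(** If [w] were negative somewhere, then at a minimum of [w + sg * (t - s)] the half-Laplacian would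
    be nonpositive and the time derivative at most [- sg], against the equation. *)
Lemma comparison {R : realType} (w : R -> R -> R) (s T : R) :
  (forall X, {within box X s T, continuous (fun p : R * R => w p.1 p.2)}) ->
  (forall x t, s < t -> t <= T -> solves w x t) ->
  (forall x, 0 <= w x s) ->
  (forall eta, 0 < eta -> exists X, forall x t, X <= `|x| -> s <= t -> t <= T ->
     - eta <= w x t) ->
  forall x t, s <= t -> t <= T -> 0 <= w x t.
Proof.
move=> cw hw w0 wy x1 t1 st1 t1T; rewrite leNgt; apply/negP => neg.
have st1' : s < t1.
  by rewrite lt_neqAle st1 andbT; apply: contraTN neg => /eqP <-; rewrite -leNgt.
pose d := t1 - s; have d0 : 0 < d by rewrite subr_gt0.
(* The penalty raises the value at [(x1, t1)] only to [w x1 t1 / 2], the level above which [w] stays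
   outside the box. *)
pose sg := - w x1 t1 / (2 * d); have sg0 : 0 < sg.
  by rewrite divr_gt0 ?oppr_gt0// mulr_gt0.
have sgd : sg * d = - w x1 t1 / 2 by rewrite /sg; field; rewrite gt_eqF.
pose phi (p : R * R) := w p.1 p.2 + sg * (p.2 - s).
have e0 : 0 < - w x1 t1 / 2 by rewrite divr_gt0 ?oppr_gt0.
have [X0 HX0] := wy _ e0.
pose X := Num.max X0 `|x1|.
have X1 : `|x1| <= X by rewrite le_max lexx orbT.
have X00 : 0 <= X by rewrite (le_trans _ X1).
have cphi : {within box X s T, continuous phi}.
  move=> p; apply: cvgD; first exact: cw.
  apply: cvgM; first exact: cvg_cst.
  apply: cvgB; last exact: cvg_cst.
  by apply: continuous_subspaceT => q; exact: cvg_snd.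
have in1 : box X s T (x1, t1).
  by split; rewrite /= in_itv/= ?st1 ?t1T// -ler_norml.
have [[x0 t0]] := compact_EVT_min (ex_intro _ _ in1) (@compact_box _ X s T) cphi.
rewrite inE => -[]; rewrite /= !in_itv/= -ler_norml => x0X /andP[st0 t0T] Hmin.
have min1 y t : `|y| <= X -> s <= t -> t <= T ->
    w x0 t0 + sg * (t0 - s) <= w y t + sg * (t - s).
  move=> yX st tT; apply: (Hmin (y, t)); rewrite inE.
  by split; rewrite /= in_itv/= ?st ?tT// -ler_norml.
have neg0 : w x0 t0 + sg * (t0 - s) <= w x1 t1 / 2.
  by rewrite (le_trans (min1 x1 t1 X1 st1 t1T))// -/d sgd; lra.
have st0' : s < t0.
  rewrite lt_neqAle st0 andbT; apply/eqP => E; have := w0 x0.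
  by move: neg0; rewrite -E subrr mulr0; lra.
have sgt0 : 0 <= sg * (t0 - s) by rewrite mulr_ge0 ?subr_ge0// ltW.
(* Outside the box [w] is at least [w x1 t1 / 2], so the minimum over the box is global in space, as
   the nonlocal operator requires. *)
have glob y : w x0 t0 <= w y t0.
  have [yX|yX] := lerP `|y| X; first by have := min1 y t0 yX st0 t0T; lra.
  have : X0 <= `|y| by rewrite (le_trans _ (ltW yX))// le_max lexx.
  by move=> /HX0 /(_ st0 t0T); lra.
have [l hl dl] := hw x0 t0 st0' t0T.
have l0 : l <= 0.
  rewrite -(mulr0 pi^-1); apply: (half_laplacian_le ltr01 hl) => e e0' _.
  rewrite -oppr_ge0 -mulN1r -RintegralZl; last 2 first.
  - exact: measurable_pv_domain.
  - by case: hl => + _; apply.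
  apply: Rintegral_ge0 => y _; rewrite mulN1r oppr_ge0.
  by rewrite /pv_integrand mulr_le0_ge0 ?subr_le0// invr_ge0 exprn_ge0.
have : - l <= - sg.
  apply: (derive_le_left st0' dl) => u su ut.
  by have := min1 x0 u x0X su (ltW (lt_le_trans ut t0T)); lra.
lra.
Qed.

Lemma cutoff_spec {R : realType} (c r : R) : 0 <= r ->
  exists chi : R -> R, [/\ continuous chi, forall x, 0 <= chi x <= 1,
    forall x, `|x - c| <= r -> chi x = 1 &
    forall x, x \notin `]c - (r + 1), c + (r + 1)[%R -> chi x = 0].
Proof.
move=> r0; exists ((fun=> 0) \max ((fun=> 1) \min (fun x : R => r + 1 - `|x - c|))); split => /=.
- move=> x; apply: (@continuous_max _ _ (fun=> 0)); first exact: cvg_cst.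
  apply: (@continuous_min _ _ (fun=> 1)); first exact: cvg_cst.
  apply: cvgB; first exact: cvg_cst.
  by apply: cvg_norm; apply: cvgB; [exact: cvg_id|exact: cvg_cst].
- by move=> x; rewrite le_max lexx/= ge_max ler01 ge_min lexx.
- move=> x xr; have h : 1 <= r + 1 - `|x - c| by lra.
  by rewrite (min_idPl h) max_r ?ler01.
- move=> x; rewrite in_itv/= => xr; rewrite max_l// ge_min.
  apply/orP; right; rewrite subr_le0 leNgt; apply: contra xr.
  by rewrite ltr_norml; lra.
Qed.

(** * Comparison of a solution with superpositions *)

Section solution_facts.
Context {R : realType} (T : \bar R) (u : R -> R -> R)
  (hu : positive_classical_solution T u).

Lemma solution_gt0 (x t : R) : 0 < t -> (t%:E < T)%E -> 0 < u x t.
Proof. by case: hu => + _ _ _ _; apply. Qed.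

Lemma solution_box (X s t : R) : 0 < s -> (t%:E < T)%E ->
  {within box X s t, continuous (fun p : R * R => u p.1 p.2)}.
Proof.
move=> s0 tT; case: hu => _ cu _ _ _; apply: continuous_subspaceW cu.
move=> [x y] [_ /=]; rewrite in_itv/= => /andP[sy yt].
by split => /=; [exact: lt_le_trans sy|exact: le_lt_trans tT].
Qed.

Lemma solution_solves (x t : R) : 0 < t -> (t%:E < T)%E -> solves u x t.
Proof.
move=> t0 tT; case: hu => _ _ du _ /(_ x t t0 tT)[l hl ul].
exists l => //; apply: DeriveDef; first exact: du.
by move: ul; rewrite derive1E => /eqP; rewrite addr_eq0 => /eqP.
Qed.

Lemma solution_continuous (t : R) : 0 < t -> (t%:E < T)%E -> continuous (u^~ t).
Proof.
move=> t0 tT x; case: hu => _ /subspace_continuousP cu _ _ _.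
have H := cu (x, t) (conj t0 tT).
apply: (@cvg_comp _ _ _ (fun y : R => (y, t)) (fun p : R * R => u p.1 p.2) _ _ _ _ H).
move=> P; rewrite /within/= => HP.
have c : ((y, t) : R * R) @[y --> x] --> (x, t).
  exact: (@cvg_pair _ _ _ (nbhs x) (nbhs x) (nbhs t) _ _ _ id (fun=> t)
    cvg_id (cvg_cst t)).
have h : nbhs x ((fun y : R => (y, t)) @^-1` (fun q => time_strip T q -> P q)).
  exact: c HP.
by apply: filterS h => y /=; apply; split.
Qed.

(** Written with [(-1) *] so that [solvesD] and [solvesZ] apply literally; [r] shifts the age of the
    kernels. *)
Definition gap (S : seq (R * R)) (r eta x t : R) : R :=
  u x t + (eta + (-1) * kernel_sum S x (t + r)).

Lemma gapE (S : seq (R * R)) (r eta x t : R) :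
  gap S r eta x t = u x t + eta - kernel_sum S x (t + r).
Proof. by rewrite /gap; ring. Qed.

Lemma gap_box (S : seq (R * R)) (r eta X s t : R) :
  0 < s -> (t%:E < T)%E -> 0 < s + r ->
  {within box X s t, continuous (fun p : R * R => gap S r eta p.1 p.2)}.
Proof.
move=> s0 tT sr p; apply: cvgD; first exact: solution_box.
apply: cvgD; first exact: cvg_cst.
apply: cvgM; first exact: cvg_cst.
have : {within box X s t, continuous (fun p : R * R => kernel_sum S p.1 (p.2 + r))}.
  rewrite continuous_subspace_in => q; rewrite inE => Hq.
  apply: continuous_subspaceT_for => //; apply: continuous_kernel_sum.
  by move: Hq => -[_ /=]; rewrite in_itv/= => /andP[sq _]; lra.
exact.
Qed.

Lemma gap_solves (S : seq (R * R)) (r eta x t : R) :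
  0 < t -> (t%:E < T)%E -> 0 < t + r -> solves (gap S r eta) x t.
Proof.
move=> t0 tT tr; apply: solvesD; first exact: solution_solves.
apply: solvesD; first exact: solves_cst.
apply: (@solvesZ _ (-1) (fun x t => kernel_sum S x (t + r))).
exact: solves_kernel_sum.
Qed.

(* A superposition of kernels agreeing with u at time s on [c - r, c + r] up to
   eta stays below u + eta by comparison, whatever the growth of u. *)
Lemma kernel_minorant (s t c r eta eps0 : R) :
  0 < s -> (t%:E < T)%E -> s <= t -> 0 <= r -> 0 < eta -> 0 < eps0 ->
  exists eps (S : seq (R * R)), [/\ 0 < eps < eps0, all (fun p => 0 <= p.1) S,
    all (fun p => c - (r + 1) <= p.2 <= c + (r + 1)) S,
    forall x, `|x - c| <= r -> `|kernel_sum S x eps - u x s| <= eta &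
    forall x y, s <= y -> y <= t -> kernel_sum S x (y + (eps - s)) <= u x y + eta].
Proof.
move=> s0 tT st r0 eta0 eps00.
have sT : (s%:E < T)%E by rewrite (le_lt_trans _ tT)// lee_fin.
have [chi [cchi chi01 chi1 chi0]] := cutoff_spec c r0.
have u0 x : 0 <= u x s by rewrite ltW// solution_gt0.
have [||||eps [S [/andP[eps1 eps2] S0 Sc HS]]] := @kernel_sum_approx R
    (fun x => u x s * chi x) (c - (r + 1)) (c + (r + 1)) eta eps0 _ _ _ _ eta0 eps00.
- lra.
- by move=> x; apply: cvgM; [exact: solution_continuous|exact: cchi].
- by move=> x; rewrite mulr_ge0//; case/andP: (chi01 x).
- by move=> x /chi0 ->; rewrite mulr0.
exists eps, S; split => //; first by rewrite eps1.
  by move=> x xr; have := HS x; rewrite chi1// mulr1.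
move=> x y sy yt; rewrite -subr_ge0.
have pos v : s <= v -> 0 < v + (eps - s) by lra.
rewrite -gapE.
have tlt t' : t' <= t -> (t'%:E < T)%E by move=> ?; rewrite (le_lt_trans _ tT)// lee_fin.
apply: (@comparison R (gap S (eps - s) eta) s t) => //.
- by move=> X; apply: gap_box => //; exact: pos.
- move=> x' t' st' t't; apply: gap_solves; [lra|exact: tlt|].
  by apply: pos; exact: ltW.
(* The sum approximates [u * chi], and [u * chi <= u] on the whole line, so the initial inequality
   also holds beyond the radius [r]. *)
- move=> x'; rewrite gapE [s + _]addrC subrK.
  have := HS x'; rewrite ler_norml => /andP[_].
  have /andP[c0 c1] := chi01 x'.
  have := ler_piMr (u0 x') c1; lra.
- move=> e e0.
  have T0 : 0 < t + (eps - s) by exact: pos.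
  have [X HX] := kernel_sum_decay T0 e0 S0.
  exists X => x' t' Xx st' t't.
  have := HX x' (t' + (eps - s)) Xx (pos _ st').
  rewrite lerD2r => /(_ t't); rewrite gapE.
  have : 0 < u x' t'.
    by apply: solution_gt0; [exact: lt_le_trans st'|exact: tlt].
  lra.
Qed.

End solution_facts.

(** * The blow-up barrier *)

(** [X] times the fixed profile [p^2 / (1 - p^2)] of [p = x / X]. By this scaling the bound on its
    half-Laplacian does not depend on [X], while on a fixed compact set the barrier is of order
    [1 / X]. *)
Definition barrier {R : realType} (X x : R) : R := X * x ^+ 2 / (X ^+ 2 - x ^+ 2).

Lemma sqr_lt_norm {R : realType} (X x : R) : `|x| < X -> 0 < X ^+ 2 - x ^+ 2.
Proof.
move=> xX; have X0 : 0 < X by exact: le_lt_trans xX.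
have -> : x ^+ 2 = `|x| ^+ 2 by rewrite real_normK ?num_real.
by rewrite subr_gt0 ltrXn2r ?nnegrE// ltW.
Qed.

Lemma barrier_ge0 {R : realType} (X x : R) : `|x| < X -> 0 <= barrier X x.
Proof.
move=> xX; have X0 : 0 < X by exact: le_lt_trans xX.
apply: divr_ge0; last exact/ltW/sqr_lt_norm.
by apply: mulr_ge0; [exact: ltW|exact: sqr_ge0].
Qed.

(** The second-order remainder is an exact rational expression. With [d = X - |x|], the bounds
    [X ^+ 2 - x ^+ 2 >= X * d] and [X ^+ 2 - y ^+ 2 >= X * d / 2], and [5 * X / d] for the last
    factor, produce the constant [10 = 2 * 5]. *)
Lemma barrier_taylor {R : realType} (X x y : R) :
  `|x| < X -> `|y - x| <= (X - `|x|) / 2 ->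
  barrier X y - barrier X x <=
  2 * X ^+ 3 * x / (X ^+ 2 - x ^+ 2) ^+ 2 * (y - x) +
  10 * X ^+ 2 / (X - `|x|) ^+ 3 * (y - x) ^+ 2.
Proof.
move=> xX yx; have X0 : 0 < X by exact: le_lt_trans xX.
set d := X - `|x| in yx *; have d0 : 0 < d by rewrite subr_gt0.
have dX : d <= X by rewrite /d gerBl.
have yX : `|y| <= X - d / 2.
  by have := ler_normD (y - x) x; rewrite subrK /d in yx *; lra.
have yX' : `|y| < X by lra.
have hx := sqr_lt_norm xX; have hy := sqr_lt_norm yX'.
have hx1 : X * d <= X ^+ 2 - x ^+ 2.
  have -> : x ^+ 2 = `|x| ^+ 2 by rewrite real_normK ?num_real.
  by rewrite /d; have := normr_ge0 x; nra.
have hy1 : X * d / 2 <= X ^+ 2 - y ^+ 2.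
  have -> : y ^+ 2 = `|y| ^+ 2 by rewrite real_normK ?num_real.
  by move: (normr_ge0 y) yX; move: `|y| => v v0 vX; nra.
set hX := (X ^+ 2 - x ^+ 2)^-1; set hY := (X ^+ 2 - y ^+ 2)^-1.
have -> : barrier X y - barrier X x =
    2 * X ^+ 3 * x / (X ^+ 2 - x ^+ 2) ^+ 2 * (y - x) +
    X ^+ 3 * hX * hY * (1 + 2 * x * (x + y) * hX) * (y - x) ^+ 2.
  rewrite /barrier /hX /hY; field.
  by rewrite !gt_eqF.
rewrite lerD2l ler_wpM2r ?sqr_ge0//.
have hX0 : 0 < hX by rewrite invr_gt0.
have hY0 : 0 < hY by rewrite invr_gt0.
have Xd : 0 < X * d by rewrite mulr_gt0.
have hXle : hX <= (X * d)^-1 by rewrite lef_pV2 ?posrE.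
have hYle : hY <= (X * d / 2)^-1 by rewrite lef_pV2 ?posrE// divr_gt0.
have q : 1 + 2 * x * (x + y) * hX <= 5 * X / d.
  have h1 : 2 * x * (x + y) <= 4 * X ^+ 2.
    have xx : x ^+ 2 <= X ^+ 2 by lra.
    have yy : y ^+ 2 <= X ^+ 2 by lra.
    by have := sqr_ge0 (x - y); lra.
  have h2 : 2 * x * (x + y) * hX <= 4 * X ^+ 2 * (X * d)^-1.
    apply: (@le_trans _ _ (4 * X ^+ 2 * hX)); first by rewrite ler_pM2r.
    by rewrite ler_pM2l// mulr_gt0// exprn_gt0.
  have h3 : 4 * X ^+ 2 * (X * d)^-1 = 4 * (X / d) by field; rewrite !gt_eqF.
  have h4 : 1 <= X / d by rewrite ler_pdivlMr// mul1r.
  by rewrite -[5 * X / d]mulrA; lra.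
have -> : 10 * X ^+ 2 / d ^+ 3 = X ^+ 3 * (X * d)^-1 * (X * d / 2)^-1 * (5 * X / d).
  by field; rewrite !gt_eqF.
have a1 : 0 <= X ^+ 3 * hX by apply: mulr_ge0; [exact/exprn_ge0/ltW|exact: ltW].
have a0 : 0 <= X ^+ 3 * hX * hY by apply: mulr_ge0; last exact: ltW.
apply: (le_trans (ler_wpM2l a0 q)); apply: ler_wpM2r.
  by apply: divr_ge0; [apply: mulr_ge0 => //; exact: ltW|exact: ltW].
apply: ler_pM => //; first exact: ltW.
by rewrite ler_pM2l// exprn_gt0.
Qed.

(** Both terms depend only on [p = |x| / X], and the claim becomes
    [20 p^3 + 100/3 p^2 - 22 p + 14/3 >= 0]; the square of [p - 33 / 100] absorbs the linear term.
    Near [p = 1] the negative barrier term outweighs the first one. *)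
Lemma barrier_numeric {R : realType} (X x : R) : `|x| < X ->
  2 * X ^+ 2 / (X - `|x|) ^+ 2 + 40 * (X / 3 - barrier X x) / (X - `|x|) <= 20.
Proof.
move=> xX; have X0 : 0 < X by exact: le_lt_trans xX.
pose p := `|x| / X; have p0 : 0 <= p by rewrite divr_ge0// ltW.
have p1 : p < 1 by rewrite ltr_pdivrMr// mul1r.
have E : `|x| = p * X by rewrite divfK// gt_eqF.
rewrite /barrier; have -> : x ^+ 2 = `|x| ^+ 2 by rewrite real_normK ?num_real.
rewrite E; clearbody p.
have q0 : 0 < 1 - p by rewrite subr_gt0.
have q1 : 0 < 1 - p ^+ 2 by nra.
have q2 : 0 < 1 + p by lra.
have -> : 2 * X ^+ 2 / (X - p * X) ^+ 2 + 40 * (X / 3 - X * (p * X) ^+ 2 /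
    (X ^+ 2 - (p * X) ^+ 2)) / (X - p * X) =
    (2 * (1 + p) + 40 * ((1 - p ^+ 2) / 3 - p ^+ 2)) / ((1 - p) ^+ 2 * (1 + p)).
  field; rewrite !gt_eqF//=.
  - have -> : X ^+ 2 - (p * X) ^+ 2 = X ^+ 2 * (1 - p ^+ 2) by ring.
    by rewrite mulr_gt0// exprn_gt0.
  - by rewrite subr_gt0 gtr_pMl.
rewrite ler_pdivrMr ?mulr_gt0 ?exprn_gt0//.
have := sqr_ge0 (p - 33 / 100); have : 0 <= p ^+ 3 by rewrite exprn_ge0.
lra.
Qed.

Lemma integrable_patch {R : realType} (D : set R) (f : R -> R) :
  measurable D -> (@lebesgue_measure R).-integrable D (EFin \o f) ->
  (@lebesgue_measure R).-integrable setT (EFin \o (f \_ D)).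
Proof.
move=> mD ih; rewrite -restrict_EFin.
by have [H _] := @integrable_mkcond _ (measurableTypeR R) R lebesgue_measure D
  (EFin \o f) mD; exact: H.
Qed.

Lemma itv_oc_pos {R : realType} (e r : R) : 0 < e ->
  `]e, r]%classic `<=` `]0, +oo[%classic.
Proof. by move=> e0 z /=; rewrite !in_itv/= andbT => /andP[ez _]; exact: lt_trans ez. Qed.

Lemma itv_oy_pos {R : realType} (e : R) : 0 < e ->
  `]e, +oo[%classic `<=` `]0, +oo[%classic.
Proof. by move=> e0 z /=; rewrite !in_itv/= !andbT; exact: lt_trans. Qed.

Lemma pv_domainU {R : realType} (x e r : R) : e < r ->
  pv_domain x e = [set y | `]e, r]%classic `|x - y|] `|` pv_domain x r.
Proof.
move=> er; apply/seteqP; split => y; rewrite /pv_domain /= in_itv/=.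
  by move=> ->; have [h|h] := leP `|x - y| r; [left|right].
by case=> [/andP[]//|]; exact: lt_trans.
Qed.

Lemma pv_domain_disj {R : realType} (x e r : R) :
  [disjoint [set y | `]e, r]%classic `|x - y|] & pv_domain x r].
Proof.
apply/disj_setPS => y; rewrite /pv_domain /= in_itv/= => -[/andP[_ h] h'].
by move: h; rewrite leNgt h'.
Qed.

Lemma pv_domain_inv2 {R : realType} (x r : R) : 0 < r ->
  (@lebesgue_measure R).-integrable (pv_domain x r)
     (EFin \o (fun y => `|x - y| ^- 2)) /\
  \int[lebesgue_measure]_(y in pv_domain x r) (`|x - y| ^- 2) = 2 / r.
Proof.
move=> r0; have [i0 E0] := ray_inv2 r0.
have ep : (fun z => `|x - (x + z)| ^- 2) = (fun z => z ^- 2).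
  apply/funext => z; rewrite opprD addrA subrr add0r normrN.
  by rewrite real_normK ?num_real.
have em : (fun z => `|x - (x - z)| ^- 2) = (fun z => z ^- 2).
  by apply/funext => z; rewrite subKr real_normK ?num_real.
have i1 : (@lebesgue_measure R).-integrable (pv_domain x r)
     (EFin \o (fun y => `|x - y| ^- 2)).
  rewrite pv_domainE; apply: integrable_shell_inv => //; first exact: itv_oy_pos.
  - by rewrite ep.
  - by rewrite em.
split => //; move: i1; rewrite pv_domainE => i1.
rewrite Rintegral_shell//; last exact: itv_oy_pos.
under eq_Rintegral.
  move=> z _; rewrite (congr1 (@^~ z) ep) (congr1 (@^~ z) em); over.
by rewrite RintegralD// E0; ring.
Qed.

(* Split at r = (X - |x|) / 20.  The part |x - y| < r costs the second
   difference of the barrier; beyond r the values f y with |y| > X / 2 cost a tail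
   integral, compensated near |x| = X by the term - f x <= - k * barrier X x. *)
Lemma barrier_half_laplacian {R : realType} (f : R -> R) (x l X k dl : R) :
  `|x| < X -> 0 < dl -> k = 40 ^+ 2 * dl ->
  is_half_laplacian f x l -> (forall y, 0 <= f y) ->
  (forall y, `|y| < X -> f y - f x <= k * (barrier X y - barrier X x)) ->
  k * barrier X x <= f x ->
  (@lebesgue_measure R).-integrable (pv_domain 0 (X / 2))
     (EFin \o (fun y => f y * `|0 - y| ^- 2)) ->
  \int[lebesgue_measure]_(y in pv_domain 0 (X / 2)) (f y * `|0 - y| ^- 2) <= dl ->
  - (10 * k) <= l.
Proof.
move=> xX dl0 kE hl f0 fb fx ih Ih.
have X0 : 0 < X by exact: le_lt_trans xX.
have k0 : 0 < k by rewrite kE mulr_gt0// exprn_gt0.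
pose d := X - `|x|; have d0 : 0 < d by rewrite subr_gt0.
pose r := d / 20; have r0 : 0 < r by rewrite divr_gt0.
have dX : d <= X by rewrite /d gerBl.
have rX : r <= X by rewrite /r; lra.
pose F := pv_integrand f x.
have intF e : 0 < e -> (@lebesgue_measure R).-integrable (pv_domain x e) (EFin \o F).
  by case: hl => + _; apply.
pose M := 10 * X ^+ 2 / d ^+ 3.
have M0 : 0 <= M by rewrite divr_ge0 ?mulr_ge0 ?exprn_ge0 ?(ltW X0) ?(ltW d0).
(* For [|y| <= X / 2] the barrier is at most [X / 3], so [lam] bounds [f y - f x] there. *)
pose lam := k * (X / 3 - barrier X x).
(* For [|x - y| > r] one has [|y| <= X + |x - y| <= (2 * X / r) * |x - y|], so [Cq] converts a tail
   weighted at [x] into one weighted at 0. *)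
pose Cq := 4 * X ^+ 2 / r ^+ 2.
have Cq0 : 0 <= Cq by apply: divr_ge0; [apply: mulr_ge0 => //; exact: sqr_ge0|exact: sqr_ge0].
have near e : 0 < e -> e < r ->
    - (2 * k * M * r) <=
    \int[lebesgue_measure]_(y in [set y | `]e, r]%classic `|x - y|]) F y.
  move=> e0 er.
  have iF : (@lebesgue_measure R).-integrable [set y | `]e, r]%classic `|x - y|] (EFin \o F).
    apply: (integrableS _ _ _ (intF e e0)).
    - exact: measurable_pv_domain.
    - exact: measurable_shell.
    - by rewrite (pv_domainU x er); exact: subsetUl.
  rewrite Rintegral_shell//; last exact: itv_oc_pos.
  have [ip im] := integrable_shell (measurable_itv _) (itv_oc_pos e0) iF.
  have murE : fine (@lebesgue_measure R `]e, r]) = r - e.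
    by rewrite lebesgue_measure_itv/= lte_fin er.
  have icst : (@lebesgue_measure R).-integrable `]e, r] (EFin \o cst (- (2 * k * M))).
    have icc : (@lebesgue_measure R).-integrable `[e, r] (EFin \o cst (- (2 * k * M))).
      apply: continuous_compact_integrable; first exact: segment_compact.
      by apply: continuous_subspaceT => z; exact: cvg_cst.
    by apply: integrableS icc => //; exact: subset_itv_oc_cc.
  apply: (@le_trans _ _ (\int[lebesgue_measure]_(z in `]e, r]) (- (2 * k * M)))).
    rewrite Rintegral_cst// murE mulNr lerN2; apply: ler_wpM2l; last lra.
    by apply: mulr_ge0 => //; apply: mulr_ge0 => //; exact: ltW.
  apply: le_Rintegral => //.
    rewrite (_ : EFin \o _ = ((EFin \o (fun z => F (x + z)%R)) \+
      (EFin \o (fun z => F (x - z)%R)))%E)//; exact: integrableD.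
  move=> z /=; rewrite in_itv/= => /andP[ez zr].
  have z0 : 0 < z by exact: lt_trans ez.
  rewrite /F pv_integrand_addl pv_integrand_subl -mulrDl.
  rewrite ler_pdivlMr ?exprn_gt0//.
  have zd : z <= d / 2 by rewrite (le_trans zr)// /r; lra.
  have b1 : `|x + z - x| <= (X - `|x|) / 2.
    by rewrite addrAC subrr add0r gtr0_norm.
  have b2 : `|x - z - x| <= (X - `|x|) / 2.
    by rewrite addrAC subrr add0r normrN gtr0_norm.
  have t1 := barrier_taylor xX b1; have t2 := barrier_taylor xX b2.
  have c1 : `|x + z| < X.
    by have := ler_normD x z; rewrite (gtr0_norm z0) /d in zd *; lra.
  have c2 : `|x - z| < X.
    by have := ler_normB x z; rewrite (gtr0_norm z0) /d in zd *; lra.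
  have f1 := fb _ c1; have f2 := fb _ c2.
  (* The linear Taylor terms at [x + z] and [x - z] cancel. *)
  have t3 : barrier X (x + z) - barrier X x + (barrier X (x - z) - barrier X x)
      <= 2 * M * z ^+ 2.
    apply: (le_trans (lerD t1 t2)); rewrite -/d -/M.
    by rewrite le_eqVlt; apply/orP; left; apply/eqP; ring.
  have := ler_wpM2l (ltW k0) t3; lra.
have far : - (Cq * dl + lam * (2 / r)) <=
    \int[lebesgue_measure]_(y in pv_domain x r) F y.
  pose h := (fun y => f y * `|0 - y| ^- 2) \_ (pv_domain 0 (X / 2)).
  have [i2 I2] := pv_domain_inv2 x r0.
  have mx : measurable (pv_domain x r) by exact: measurable_pv_domain.
  have m0 : measurable (pv_domain 0 (X / 2)) by exact: measurable_pv_domain.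
  have ih' : (@lebesgue_measure R).-integrable (pv_domain x r) (EFin \o h).
    have ihT : (@lebesgue_measure R).-integrable setT (EFin \o h) by exact: integrable_patch.
    by apply: integrableS ihT => //; exact: measurableT.
  have Ih' : \int[lebesgue_measure]_(y in pv_domain x r) h y <= dl.
    apply: le_trans Ih; rewrite -Rintegral_mkcondr.
    have mI : measurable (pv_domain x r `&` pv_domain 0 (X / 2)) by exact: measurableI.
    have iI : (@lebesgue_measure R).-integrable (pv_domain x r `&` pv_domain 0 (X / 2))
      (EFin \o (fun y => f y * `|0 - y| ^- 2)).
      by apply: integrableS ih => //; exact: subIsetr.
    apply: fine_le; [exact: integrable_fin_num|exact: integrable_fin_num|].
    apply: (@ge0_subset_integral _ (measurableTypeR R) R lebesgue_measure
      _ _ mI m0) => [|y _|]; last exact: subIsetr.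
      exact: measurable_int ih.
    by rewrite lee_fin mulr_ge0// invr_ge0 exprn_ge0.
  have iCh : (@lebesgue_measure R).-integrable (pv_domain x r)
      (EFin \o (fun y => Cq * h y)).
    rewrite (_ : EFin \o _ = (fun y => Cq%:E * (EFin \o h) y)%E)//.
    exact: integrableZl.
  have il2 : (@lebesgue_measure R).-integrable (pv_domain x r)
      (EFin \o (fun y => lam * `|x - y| ^- 2)).
    rewrite (_ : EFin \o _ = (fun y => lam%:E * (EFin \o (fun y => `|x - y| ^- 2)%R) y)%E)//.
    exact: integrableZl.
  have isum : (@lebesgue_measure R).-integrable (pv_domain x r)
      (EFin \o (fun y => Cq * h y + lam * `|x - y| ^- 2)).
    rewrite (_ : EFin \o _ = ((EFin \o (fun y => Cq * h y)%R) \+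
      (EFin \o (fun y => lam * `|x - y| ^- 2)%R))%E)//.
    exact: integrableD.
  have iF := intF r r0.
  rewrite lerNl -mulN1r -RintegralZl//.
  apply: (@le_trans _ _ (\int[lebesgue_measure]_(y in pv_domain x r)
     (Cq * h y + lam * `|x - y| ^- 2))); last first.
    by rewrite RintegralD// !RintegralZl// I2 lerD2r ler_wpM2l.
  apply: le_Rintegral => //.
    rewrite (_ : EFin \o _ = (fun y => (-1)%:E * (EFin \o F) y)%E)//.
    exact: integrableZl.
  move=> y; rewrite /pv_domain/= => ry.
  have y0 : 0 < `|x - y| by exact: lt_trans ry.
  have yx2 : 0 < `|x - y| ^+ 2 by rewrite exprn_gt0.
  rewrite /F /pv_integrand mulN1r -mulNr opprB.
  rewrite ler_pdivrMr// mulrDl -mulrA -[lam * _ * _]mulrA mulVf ?gt_eqF// mulr1.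
  have gx := barrier_ge0 xX.
  have [yX|yX] := leP `|y| (X / 2).
    have yX' : `|y| < X by lra.
    have h0 : h y = 0.
      rewrite /h patchE memNset//= /pv_domain/= sub0r normrN.
      by apply/negP; rewrite -leNgt.
    rewrite h0 mul0r mulr0 add0r.
    apply: (le_trans (fb _ yX')); rewrite ler_pM2l// lerD2r.
    rewrite /barrier; have hy := sqr_lt_norm yX'.
    rewrite ler_pdivrMr//.
    have y2 : y ^+ 2 <= X ^+ 2 / 4.
      have -> : y ^+ 2 = `|y| ^+ 2 by rewrite real_normK ?num_real.
      by move: (normr_ge0 y) yX; move: `|y| => v v0 vX; nra.
    by rewrite -mulrA ler_pM2l//; lra.
  have hE : h y = f y * `|0 - y| ^- 2.
    by rewrite /h patchE mem_set//= /pv_domain/= sub0r normrN.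
  have fy : f y <= Cq * (h y * `|x - y| ^+ 2).
    rewrite hE sub0r normrN.
    have yy0 : 0 < `|y| by rewrite (lt_trans _ yX)// divr_gt0.
    have -> : Cq * (f y / `|y| ^+ 2 * `|x - y| ^+ 2) =
        f y * ((2 * X / r * `|x - y|) / `|y|) ^+ 2.
      by rewrite /Cq; field; rewrite !gt_eqF.
    rewrite ler_peMr// -[leLHS](expr1n _ 2) lerXn2r ?nnegrE//.
      by rewrite !mulr_ge0 ?invr_ge0// ?normr_ge0// ltW.
    rewrite ler_pdivlMr// mul1r.
    have yle : `|y| <= X + `|x - y|.
      have := ler_normB x (x - y); rewrite subKr; lra.
    apply: (le_trans yle).
    have : X <= X / r * `|x - y|.
      rewrite -[leLHS]mulr1 -mulrA ler_pM2l// mulrC ler_pdivlMr// mul1r.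
      exact: ltW.
    have : `|x - y| <= X / r * `|x - y|.
      by rewrite ler_peMl// ler_pdivlMr// mul1r.
    rewrite -[2 * X / r]mulrA; lra.
  apply: lerD => //.
  apply: (@le_trans _ _ (- (k * barrier X x))); first by rewrite lerN2.
  by rewrite /lam mulrBr -[leLHS]add0r lerD2r mulr_ge0 ?(ltW k0)// divr_ge0// ltW.
have P2 := pi_ge2 R; have P0 := pi_gt0 R.
(* [pi >= 2] turns [20 * k / pi] into at most [10 * k]. *)
suff : pi^-1 * - (20 * k) <= l.
  apply: le_trans; rewrite mulrN lerN2 ler_pdivrMl//; nra.
apply: (half_laplacian_ge r0 hl) => e e0 er.
rewrite (pv_domainU x er) Rintegral_setU//; last 4 first.
- exact: measurable_shell.
- exact: measurable_pv_domain.
- by rewrite -(pv_domainU x er); exact: intF.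
- exact: pv_domain_disj.
apply: (le_trans _ (lerD (near e e0 er) far)).
rewrite -opprD lerN2.
(* With [r = d / 20] and [dl = k / 40 ^+ 2], the terms of [M] and [Cq] contribute
   [k * X ^+ 2 / d ^+ 2] each. *)
have -> : 2 * k * M * r + (Cq * dl + lam * (2 / r)) =
    k * (2 * X ^+ 2 / d ^+ 2 + 40 * (X / 3 - barrier X x) / d).
  have -> : dl = k / 40 ^+ 2 by rewrite kE; field.
  by rewrite /M /Cq /lam /r; field; rewrite !gt_eqF.
by rewrite mulrC ler_pM2r// barrier_numeric.
Qed.

(* Maximum principle on |x| < X against a barrier that blows up at |x| = X, so
   that no growth condition on w is needed; only its tail integrals enter. *)
Lemma barrier_comparison {R : realType} (w : R -> R -> R) (s T b X dl : R) :
  0 < X -> 0 < dl -> 0 <= b ->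
  (forall Y, {within box Y s T, continuous (fun p : R * R => w p.1 p.2)}) ->
  (forall x t, s < t -> t <= T -> solves w x t) ->
  (forall x t, s <= t -> t <= T -> 0 <= w x t) ->
  (forall x, `|x| < X -> w x s <= b) ->
  (forall t, s < t -> t <= T ->
    (@lebesgue_measure R).-integrable (pv_domain 0 (X / 2))
      (EFin \o (fun y => w y t * `|0 - y| ^- 2)) /\
    \int[lebesgue_measure]_(y in pv_domain 0 (X / 2)) (w y t * `|0 - y| ^- 2)
      <= dl) ->
  forall x t, `|x| < X -> s <= t -> t <= T ->
    w x t <= b + 40 ^+ 2 * dl * (barrier X x + 12 * (t - s)).
Proof.
move=> X0 dl0 b0 cw hw w0 ws wI x1 t1 x1X st1 t1T; rewrite leNgt; apply/negP => bad.
pose k := 40 ^+ 2 * dl; have k0 : 0 < k by rewrite mulr_gt0// exprn_gt0.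
rewrite -/k in bad.
have sT : s <= T by exact: le_trans t1T.
have inX (Y : R) : 0 <= Y -> box Y s T (0, s).
  by move=> Y0; split; rewrite /= in_itv/= ?lexx ?sT// oppr_le0 Y0.
have [[xm tm] _ Hm] := compact_EVT_max (ex_intro _ _ (inX X (ltW X0)))
  (@compact_box _ X s T) (cw X).
pose M := `|w xm tm|.
have wM x t : `|x| <= X -> s <= t -> t <= T -> w x t <= M.
  move=> xX st tT; apply: (le_trans _ (ler_norm _)).
  by apply: (Hm (x, t)); rewrite inE; split; rewrite /= in_itv/= ?st ?tT// -ler_norml.
(* The relative width of a layer at [|x| = X] in which [k * barrier] alone exceeds the bound [M] of
   [w]; a positive maximum of [W] cannot lie there, so a compact box suffices. *)
pose th := Num.min (1 / 2) (k * X / (8 * (M + 1))).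
have M1 : 0 < M + 1 by rewrite ltr_wpDl// normr_ge0.
have th0 : 0 < th by rewrite lt_min !divr_gt0// mulr_gt0.
have th1 : th <= 1 / 2 by rewrite ge_min lexx.
have th2 : th * (8 * (M + 1)) <= k * X.
  by rewrite -ler_pdivlMr ?mulr_gt0// ge_min lexx orbT.
clearbody th.
pose Y := Num.max `|x1| (X * (1 - th)).
have YX : Y < X by rewrite gt_max x1X/= gtr_pMr//; lra.
have x1Y : `|x1| <= Y by rewrite le_max lexx.
have Y0 : 0 <= Y by exact: le_trans x1Y.
have edge x : Y <= `|x| -> `|x| < X -> M < k * barrier X x.
  move=> Yx xX; have hx := sqr_lt_norm xX.
  rewrite /barrier mulrA ltr_pdivlMr//.
  have xl : X * (1 - th) <= `|x| by rewrite (le_trans _ Yx)// le_max lexx orbT.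
  have -> : x ^+ 2 = `|x| ^+ 2 by rewrite real_normK ?num_real.
  have q1 : X ^+ 2 - `|x| ^+ 2 <= 2 * th * X ^+ 2.
    have : (X * (1 - th)) ^+ 2 <= `|x| ^+ 2.
      by rewrite lerXn2r ?nnegrE// mulr_ge0 ?(ltW X0)//; lra.
    have : 0 <= th ^+ 2 * X ^+ 2 by rewrite mulr_ge0// sqr_ge0.
    rewrite exprMn; lra.
  have q2 : X ^+ 2 / 4 <= `|x| ^+ 2.
    have -> : X ^+ 2 / 4 = (X / 2) ^+ 2 by field.
    rewrite lerXn2r ?nnegrE//; first by rewrite divr_ge0// ltW.
    by apply: le_trans xl; rewrite ler_pM2l//; lra.
  have X2 : 0 < X ^+ 2 by rewrite exprn_gt0.
  apply: (@le_lt_trans _ _ (M * (2 * th * X ^+ 2))); first by rewrite ler_wpM2l// normr_ge0.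
  apply: (@lt_le_trans _ _ (k * (X * (X ^+ 2 / 4)))); last first.
    by rewrite ler_pM2l// ler_pM2l.
  have -> : M * (2 * th * X ^+ 2) = (th * (8 * M)) * (X ^+ 2 / 4) by field.
  have -> : k * (X * (X ^+ 2 / 4)) = k * X * (X ^+ 2 / 4) by ring.
  rewrite ltr_pM2r ?divr_gt0//; lra.
pose B (p : R * R) := b + k * (barrier X p.1 + 12 * (p.2 - s)).
pose W (p : R * R) := w p.1 p.2 - B p.
have cW : {within box Y s T, continuous W}.
  move=> p; apply: cvgB; first exact: cw.
  have : {within box Y s T, continuous B}.
    rewrite continuous_subspace_in => q; rewrite inE => Hq.
    have qX : `|q.1| < X.
      move: Hq => -[/=]; rewrite in_itv/= -ler_norml => qY _.
      exact: le_lt_trans YX.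
    apply: continuous_subspaceT_for => //.
    apply: cvgD; first exact: cvg_cst.
    apply: cvgM; first exact: cvg_cst.
    apply: cvgD.
      have c1 : (q'.1 ^+ 2) @[q' --> q] --> q.1 ^+ 2.
        by apply: cvgM; exact: cvg_fst.
      apply: cvgM; first by apply: cvgM => //; exact: cvg_cst.
      apply: cvgV; first by rewrite gt_eqF// sqr_lt_norm.
      by apply: cvgB => //; exact: cvg_cst.
    apply: cvgM; first exact: cvg_cst.
    by apply: cvgB; [exact: cvg_snd|exact: cvg_cst].
  exact.
have in1 : box Y s T (x1, t1).
  by split; rewrite /= in_itv/= ?st1 ?t1T// -ler_norml.
have [[x0 t0]] := compact_EVT_max (ex_intro _ _ in1) (@compact_box _ Y s T) cW.
rewrite inE => -[]; rewrite /= !in_itv/= -ler_norml => x0Y /andP[st0 t0T] Hmax.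
have x0X : `|x0| < X by exact: le_lt_trans YX.
have Wpos : 0 < W (x0, t0).
  apply: (@lt_le_trans _ _ (W (x1, t1))); first by rewrite subr_gt0.
  by apply: Hmax; rewrite inE.
have Bs x t : `|x| < X -> s <= t -> 0 <= k * (barrier X x + 12 * (t - s)).
  move=> xX st; apply: mulr_ge0; first exact: ltW.
  by have := barrier_ge0 xX; lra.
have max1 x t : `|x| < X -> s <= t -> t <= T -> W (x, t) <= W (x0, t0).
  move=> xX st tT; have [xY|xY] := lerP `|x| Y.
    by apply: Hmax; rewrite inE; split; rewrite /= in_itv/= ?st ?tT// -ler_norml.
  apply: ltW; apply: le_lt_trans Wpos; rewrite subr_le0 /B/=.
  have := edge x (ltW xY) xX; have := wM x t (ltW xX) st tT.
  have : 0 <= k * (12 * (t - s)) by apply: mulr_ge0; [exact: ltW|lra].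
  rewrite mulrDr; lra.
have st0' : s < t0.
  rewrite lt_neqAle st0 andbT; apply/eqP => E.
  move: Wpos; rewrite /W /B/= -E; have := ws _ x0X.
  by have := Bs x0 s x0X (lexx s); lra.
have [l hl dl'] := hw x0 t0 st0' t0T.
have [iI II] := wI t0 st0' t0T.
have L1 : - (10 * k) <= l.
  apply: (@barrier_half_laplacian _ (w^~ t0) x0 l X k dl) => //.
  - by move=> y; exact: w0.
  - move=> y yX; have := max1 y t0 yX st0 t0T; rewrite /W /B/= !mulrDr.
    lra.
  - move: Wpos; rewrite /W /B/= mulrDr.
    have : 0 <= k * (12 * (t0 - s)) by apply: mulr_ge0; [exact: ltW|lra].
    lra.
(* At the maximum [w] grows at least as fast as the barrier, that is at rate [12 * k]; the spatial
   estimate allows only [10 * k]. *)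
have : 12 * k <= - l.
  apply: (derive_ge_left st0' dl') => u su ut.
  have := max1 x0 u x0X su (ltW (lt_le_trans ut t0T)).
  rewrite /W /B/= !mulrDr; lra.
lra.
Qed.

(** * Uniform smallness of the tails *)

Lemma ge0_integral_tail {R : realType} (G : R -> \bar R) (N : nat) :
  measurable_fun (`[N%:R, +oo[%classic : set R) G -> (forall z, N%:R <= z -> (0 <= G z)%E) ->
  (\int[lebesgue_measure]_(z in `[N%:R, +oo[) G z =
   \sum_(N <= k <oo) \int[lebesgue_measure]_(z in `[k%:R, k.+1%:R[) G z)%E.
Proof.
move=> mG G0.
pose F k : set R := if (N <= k)%N then `[k%:R, k.+1%:R[%classic else set0.
have FE : `[N%:R, +oo[%classic = \bigcup_k F k.
  apply/seteqP; split => z /=.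
    rewrite in_itv/= andbT => Nz.
    have z0 : 0 <= z by rewrite (le_trans _ Nz).
    exists (Num.truncn z) => //; rewrite /F.
    have /andP[t1 t2] := truncn_itv z0.
    have -> : (N <= Num.truncn z)%N.
      by rewrite -ltnS -(@ltr_nat R) (le_lt_trans Nz).
    by rewrite /= in_itv/= t1 t2.
  move=> [k _]; rewrite /F; case: ifPn => // Nk; rewrite /= !in_itv/= => /andP[kz _].
  by rewrite andbT (le_trans _ kz)// ler_nat.
have mF k : measurable (F k) by rewrite /F; case: ifP.
rewrite FE ge0_integral_bigcup//; first last.
- move=> i j _ _ [z []]; rewrite /F; case: ifPn => // _ + ; case: ifPn => // _.
  rewrite /= !in_itv/= => /andP[iz zi] /andP[jz zj].
  apply/eqP; rewrite eqn_leq; apply/andP; split.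
    by rewrite -ltnS -(@ltr_nat R) (le_lt_trans iz).
  by rewrite -ltnS -(@ltr_nat R) (le_lt_trans jz).
- by move=> z [k _]; rewrite /F; case: ifPn => // Nk; rewrite /= in_itv/= => /andP[kz _];
    apply: G0; rewrite (le_trans _ kz)// ler_nat.
- by rewrite -FE.
rewrite [RHS]eseries_cond [RHS]eseries_mkcond; apply: eq_eseriesr => k _.
by rewrite /F; case: ifP => // _; rewrite integral_set0.
Qed.

Lemma ge0_integral_tail_cvg {R : realType} (G : R -> \bar R) :
  measurable_fun (`[1, +oo[%classic : set R) G ->
  (forall z, 1 <= z -> (0 <= G z)%E) ->
  (\int[lebesgue_measure]_(z in `[1%R, +oo[) G z < +oo)%E ->
  (\int[lebesgue_measure]_(z in `[N%:R, +oo[) G z)%E @[N --> \oo] --> (0 : \bar R)%E.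
Proof.
move=> mG G0 fin.
have E N : (1 <= N)%N -> (\int[lebesgue_measure]_(z in `[N%:R, +oo[) G z =
   \sum_(N <= k <oo) \int[lebesgue_measure]_(z in `[k%:R, k.+1%:R[) G z)%E.
  move=> N1; have N1' : (1 : R) <= N%:R by rewrite ler1n.
  apply: ge0_integral_tail => [|z Nz]; last by apply: G0; exact: le_trans Nz.
  apply: measurable_funS mG => // z /=; rewrite !in_itv/= !andbT.
  exact: le_trans.
pose A k := if (1 <= k)%N then (\int[lebesgue_measure]_(z in `[k%:R, k.+1%:R[) G z)%E
  else 0%E.
have A0 k : (0 <= A k)%E.
  rewrite /A; case: ifPn => // k1; apply: integral_ge0 => z /=.
  rewrite in_itv/= => /andP[kz _]; apply: G0; apply: le_trans kz; by rewrite ler1n.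
have SA N : (1 <= N)%N -> (\int[lebesgue_measure]_(z in `[N%:R, +oo[) G z =
   \sum_(N <= k <oo) A k)%E.
  move=> N1; rewrite E// eseries_cond [RHS]eseries_cond.
  by apply: eq_eseriesr => k /= Nk; rewrite /A (leq_trans N1).
have : (\sum_(N <= k <oo) A k)%E @[N --> \oo] --> (0 : \bar R)%E.
  apply: (@nneseries_tail_cvg R A predT) => //.
  rewrite (nneseries_recl (P := predT))// {1}/A/= add0e.
  by rewrite -SA.
apply: cvg_trans; apply: near_eq_cvg; near=> N.
by rewrite SA//; near: N; exact: nbhs_infty_ge.
Unshelve. all: by end_near. Qed.

(** The mass of [f] on a unit cell is bounded by every value of [C * g] on it, hence by its mean. On
    the cell from [k] to [k + 1] with [k >= 1] the weight varies by a factor at most 4. *)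
Lemma ge0_integral_tail_compare {R : realType} (f g : R -> R) (C : R) :
  continuous f -> continuous g -> (forall z, 0 <= f z) -> (forall z, 0 <= g z) ->
  0 <= C ->
  (forall (n : nat) x, n%:R <= x -> x <= n.+1%:R ->
    (\int[lebesgue_measure]_(z in `[n%:R, n.+1%:R[) (f z)%:E <= (C * g x)%:E)%E) ->
  forall N, (1 <= N)%N ->
  (\int[lebesgue_measure]_(z in `[N%:R, +oo[) (f z * z ^- 2)%:E <=
   (4 * C)%:E * \int[lebesgue_measure]_(z in `[N%:R, +oo[) (g z * z ^- 2)%:E)%E.
Proof.
move=> cf cg f0 g0 C0 fg N N1.
have N0 : (0 : R) < N%:R by rewrite ltr0n.
have m2 : measurable_fun (`]0, +oo[%classic : set R) (fun z : R => z ^- 2).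
  apply: open_continuous_measurable_fun; first exact: interval_open.
  move=> z; rewrite inE/= in_itv/= andbT => z0.
  by apply: cvgV; [rewrite expf_neq0// gt_eqF|exact: exprn_continuous].
have mh (h : R -> R) (D : set R) : continuous h -> measurable D ->
    D `<=` `]0, +oo[%classic ->
    measurable_fun D (fun z => (h z * z ^- 2)%:E).
  move=> ch mD D0; apply/measurable_EFinP; apply: measurable_funM.
    by apply: measurable_funTS; exact: continuous_measurable_fun.
  exact: measurable_funS m2.
have NyS : `[N%:R : R, +oo[%classic `<=` `]0, +oo[%classic.
  by move=> z /=; rewrite !in_itv/= !andbT; exact: lt_le_trans.
have h0 (h : R -> R) z : 0 <= h z -> (0 <= (h z * z ^- 2)%:E)%E.
  by move=> hz; rewrite lee_fin mulr_ge0// invr_ge0 sqr_ge0.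
rewrite [X in (X <= _)%E](@ge0_integral_tail _ (fun z => (f z * z ^- 2)%:E)); first last.
- by move=> z _; exact: h0.
- exact: mh.
rewrite [X in (_ <= _ * X)%E](@ge0_integral_tail _ (fun z => (g z * z ^- 2)%:E)); first last.
- by move=> z _; exact: h0.
- exact: mh.
rewrite eseries_cond [X in (_ <= _ * X)%E]eseries_cond -nneseriesZl//; last first.
  by move=> k _; apply: integral_ge0 => z _; exact: h0.
apply: lee_nneseries => [k _ _|k /= Nk].
  by apply: integral_ge0 => z _; exact: h0.
have k0 : (0 : R) < k%:R by rewrite ltr0n (leq_trans N1).
have k1 : (1 : R) <= k%:R by rewrite ler1n (leq_trans N1).
have kS : `[k%:R : R, k.+1%:R[%classic `<=` `]0, +oo[%classic.
  by move=> z /=; rewrite !in_itv/= !andbT => /andP[kz _]; exact: lt_le_trans kz.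
set A := (\int[lebesgue_measure]_(z in `[k%:R, k.+1%:R[) (f z)%:E)%E.
have A0 : (0 <= A)%E by apply: integral_ge0 => z _; rewrite lee_fin.
have Afin : A \is a fin_num.
  rewrite ge0_fin_numE//; apply: le_lt_trans (ltry (C * g k%:R)).
  by apply: fg => //; rewrite ler_nat.
have mu1 : @lebesgue_measure R `[k%:R, k.+1%:R[ = 1%E.
  rewrite lebesgue_measure_itv/= lte_fin ltr_nat ltnSn -EFinB.
  by congr EFin; rewrite -natr1; ring.
apply: (@le_trans _ _ ((k%:R ^- 2)%:E * A)%E).
  rewrite /A -ge0_integralZl_EFin//; last 2 first.
  - by move=> z _; rewrite lee_fin.
  - by apply/measurable_EFinP; apply: measurable_funTS; exact: continuous_measurable_fun.
  apply: ge0_le_integral => //.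
  - by move=> z _; exact: h0.
  - exact: mh.
  - apply: measurable_funeM; apply/measurable_EFinP; apply: measurable_funTS.
    exact: continuous_measurable_fun.
  move=> z /=; rewrite in_itv/= => /andP[kz _].
  rewrite -EFinM lee_fin mulrC ler_wpM2r//.
  rewrite lef_pV2 ?posrE ?exprn_gt0//; last exact: lt_le_trans kz.
  by rewrite lerXn2r ?nnegrE ?(ltW k0)// (le_trans (ltW k0)).
have -> : ((k%:R ^- 2)%:E * A = \int[lebesgue_measure]_(z in `[k%:R : R, k.+1%:R[)
    (k%:R ^- 2 * fine A)%:E)%E.
  rewrite integral_cst//= EFinM fineK// -[LHS]mule1.
  by congr (_ * _)%E; rewrite mu1.
rewrite -ge0_integralZl_EFin//; last 3 first.
- by move=> z _; exact: h0.
- exact: mh.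
- by rewrite mulr_ge0.
apply: ge0_le_integral => //.
- by move=> z _; rewrite lee_fin mulr_ge0 ?fine_ge0// invr_ge0 sqr_ge0.
- by apply: measurable_funeM; exact: mh.
move=> z /=; rewrite in_itv/= => /andP[kz zk]; rewrite -EFinM lee_fin.
have fA : fine A <= C * g z.
  by rewrite -lee_fin fineK//; apply: fg => //; exact: ltW.
apply: (le_trans (ler_wpM2l _ fA)); first by rewrite invr_ge0 sqr_ge0.
have z0 : 0 < z by exact: lt_le_trans kz.
have zz : z <= 2 * k%:R by move: zk; rewrite -natr1; lra.
have kz2 : k%:R ^- 2 <= 4 * z ^- 2.
  rewrite -[leLHS]mul1r ler_pdivrMr ?exprn_gt0// mulrAC ler_pdivlMr ?exprn_gt0//.
  rewrite mul1r; have -> : 4 * (k%:R : R) ^+ 2 = (2 * k%:R) ^+ 2 by ring.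
  by rewrite lerXn2r ?nnegrE ?(ltW z0)// mulr_ge0// ltW.
have Cg : 0 <= C * g z by rewrite mulr_ge0.
by apply: (le_trans (ler_wpM2r Cg kz2)); rewrite le_eqVlt; apply/orP; left; apply/eqP; ring.
Qed.

Lemma Rintegral_heat_kernel_le1 {R : realType} (a b c t : R) : 0 < t -> b < c ->
  \int[lebesgue_measure]_(y in `[b, c]) heat_kernel (y - a) t <= 1.
Proof.
move=> t0 bc; pose g y := atan ((y - a) / t) / pi.
have dg (y : R) : is_derive y 1 g (heat_kernel (y - a) t).
  exact: is_derive_atan_heat_kernel.
have cg (y : R) : {for y, continuous g}.
  by apply/differentiable_continuous/derivable1_diffP; case: (dg y).
rewrite /Rintegral (@continuous_FTC2 _ _ g)//.
- rewrite -EFinB/= /g -mulrBl ler_pdivrMr ?pi_gt0// mul1r.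
  by have := atan_ltpi2 ((c - a) / t); have := atan_gtNpi2 ((b - a) / t); lra.
- by apply: continuous_subspaceT; exact: continuous_heat_kernel.
- split; first by move=> y _; case: (dg y).
  + exact/cvg_at_right_filter/cg.
  + exact/cvg_at_left_filter/cg.
- by move=> y _; rewrite derive1E; case: (dg y).
Qed.

Lemma continuous_kernel_sum1 {R : realType} (S : seq (R * R)) (t : R) : 0 < t ->
  continuous (fun x => kernel_sum S x t).
Proof.
move=> t0 x; elim: S => [|p S IH].
  rewrite (_ : (fun _ => _) = fun=> 0); first exact: cvg_cst.
  by apply/funext => y; rewrite /kernel_sum big_nil.
rewrite (_ : (fun _ => _) = fun y => p.1 * heat_kernel (y - p.2) t + kernel_sum S y t).
  apply: cvgD; last exact: IH.
  by apply: cvgM; [exact: cvg_cst|exact: continuous_heat_kernel].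
by apply/funext => y; rewrite /kernel_sum big_cons.
Qed.

Lemma integrable_itv_continuous {R : realType} (f : R -> R) (b c : R) :
  continuous f -> (@lebesgue_measure R).-integrable `[b, c] (EFin \o f).
Proof.
move=> cf; apply: continuous_compact_integrable; first exact: segment_compact.
exact: continuous_subspaceT.
Qed.

Lemma Rintegral_kernel_sum_le {R : realType} (S : seq (R * R)) (b c t : R) :
  0 < t -> b < c -> all (fun p => 0 <= p.1) S ->
  \int[lebesgue_measure]_(y in `[b, c]) kernel_sum S y t <= \sum_(p <- S) p.1.
Proof.
move=> t0 bc; elim: S => [_|p S IH /= /andP[p0 S0]].
  rewrite big_nil (_ : (fun y => _) = fun=> 0).
    by rewrite Rintegral_cst// mul0r.
  by apply/funext => y; rewrite /kernel_sum big_nil.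
rewrite big_cons (_ : (fun y => _) =
    fun y => p.1 * heat_kernel (y - p.2) t + kernel_sum S y t); last first.
  by apply/funext => y; rewrite /kernel_sum big_cons.
have ck : continuous (fun y => heat_kernel (y - p.2) t) by exact: continuous_heat_kernel.
rewrite RintegralD//; last 2 first.
- apply: integrable_itv_continuous => x.
  by apply: cvgM; [exact: cvg_cst|exact: ck].
- by apply: integrable_itv_continuous; exact: continuous_kernel_sum1.
rewrite RintegralZl//; last exact: integrable_itv_continuous.
rewrite lerD ?IH// -[leRHS]mulr1 ler_wpM2l//.
exact: Rintegral_heat_kernel_le1.
Qed.

(** The minorant started at time [t] carries almost all the mass of [u] on the cell, and by time
    [t2] its kernels have spread over the whole cell. The constant depends neither on the cell nor
    on [t]. *)
Lemma solution_unit_mass {R : realType} (T : \bar R) (u : R -> R -> R)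
    (s t1 t2 : R) : positive_classical_solution T u ->
  0 < s -> s <= t1 -> t1 < t2 -> (t2%:E < T)%E ->
  exists2 C, 0 < C & forall t, s <= t -> t <= t1 -> forall z x, z <= x -> x <= z + 1 ->
    \int[lebesgue_measure]_(y in `[z, z + 1]) u y t <= C * u x t2.
Proof.
move=> hu s0 st1 t12 t2T.
pose sg := t2 - t1; have sg0 : 0 < sg by rewrite subr_gt0.
have P0 := pi_gt0 R.
have t20 : 0 < t2 by lra.
have D0 : 0 < (t2 + 1) ^+ 2 + 4 by rewrite ltr_wpDl// sqr_ge0.
(* A lower bound for kernels of age between [sg] and [t2 + 1] at distance at most 2 from the centre;
   the centres lie between [z - 1] and [z + 2]. *)
pose k := sg / pi / ((t2 + 1) ^+ 2 + 4).
have k0 : 0 < k by rewrite !divr_gt0.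
exists k^-1; first by rewrite invr_gt0.
move=> t st tt1 z x zx xz.
have t0 : 0 < t by lra.
have tT : (t%:E < T)%E by rewrite (le_lt_trans _ t2T)// lee_fin; lra.
apply/ler_addgt0Pr => e e0.
(* The error [eta] enters once on the cell and once at time [t2], there multiplied by [k^-1]. *)
pose eta := e / (k^-1 + 1).
have k1 : 0 < k^-1 + 1 by rewrite ltr_wpDl// invr_ge0 ltW.
have eta0 : 0 < eta by rewrite divr_gt0.
have [||eps [S [/andP[eps0 eps1] S0 Sc Sz Su]]] :=
  @kernel_minorant R T u hu t t2 (z + 1 / 2) (1 / 2) eta 1 t0 t2T _ _ eta0 ltr01.
- lra.
- lra.
have low : k * \sum_(p <- S) p.1 <= u x t2 + eta.
  apply: le_trans (Su x t2 _ (lexx _)); last by lra.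
  rewrite /kernel_sum mulr_sumr [leLHS]big_seq [leRHS]big_seq; apply: ler_sum => p pS.
  rewrite mulrC ler_wpM2l//; first exact: (allP S0).
  have := allP Sc p pS => /= /andP[p1 p2].
  rewrite heat_kernelE; last by lra.
  have xp : (x - p.2) ^+ 2 <= 4.
    have -> : (x - p.2) ^+ 2 = `|x - p.2| ^+ 2 by rewrite real_normK ?num_real.
    have -> : (4 : R) = 2 ^+ 2 by ring.
    by rewrite lerXn2r ?nnegrE// ler_norml; lra.
  have tl : sg <= t2 + (eps - t) by rewrite /sg; lra.
  apply: ler_pM.
  - by rewrite divr_ge0 ?(ltW sg0)// ltW.
  - by rewrite invr_ge0 ltW.
  - by rewrite ler_pM2r ?invr_gt0.
  - rewrite lef_pV2 ?posrE//; last by rewrite ltr_pwDl ?exprn_gt0 ?sqr_ge0//; lra.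
    by rewrite lerD// lerXn2r ?nnegrE; lra.
have cu : continuous (u^~ t) by exact: (solution_continuous hu).
have ck : continuous (fun y => kernel_sum S y eps) by exact: continuous_kernel_sum1.
have up : \int[lebesgue_measure]_(y in `[z, z + 1]) u y t <= \sum_(p <- S) p.1 + eta.
  apply: (@le_trans _ _ (\int[lebesgue_measure]_(y in `[z, z + 1])
      (kernel_sum S y eps + eta))).
    apply: le_Rintegral => //.
    - exact: integrable_itv_continuous.
    - apply: integrable_itv_continuous => y.
      by apply: cvgD; [exact: ck|exact: cvg_cst].
    move=> y /=; rewrite in_itv/= => /andP[zy yz].
    have : `|y - (z + 1 / 2)| <= 1 / 2 by rewrite ler_norml; lra.
    by move=> /Sz; rewrite ler_norml => /andP[]; lra.
  rewrite RintegralD//; last 2 first.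
  - exact: integrable_itv_continuous.
  - by apply: integrable_itv_continuous => y; exact: cvg_cst.
  apply: lerD; first by apply: Rintegral_kernel_sum_le => //; lra.
  rewrite Rintegral_cst//= lebesgue_measure_itv/= lte_fin ltrDl ltr01.
  by rewrite -EFinB/=; lra.
apply: (le_trans up).
have : \sum_(p <- S) p.1 <= k^-1 * (u x t2 + eta) by rewrite ler_pdivlMl.
have : eta * (k^-1 + 1) = e by rewrite divfK// gt_eqF.
rewrite !mulrDr mulr1; lra.
Qed.

Lemma continuous_comp_oppr {R : realType} (g : R -> R) :
  continuous g -> continuous (fun z => g (- z)).
Proof.
move=> cg z; apply: (@continuous_comp _ _ _ (@GRing.opp R) g); last exact: cg.
exact: opp_continuous.
Qed.

(** In the truncated integrand the part with the constant [f x] is integrable on its own, so the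
    part with [f y] is as well. *)
Lemma integrable_half_laplacian_tail {R : realType} (f : R -> R) (x l e : R) :
  is_half_laplacian f x l -> 0 < e ->
  (@lebesgue_measure R).-integrable (pv_domain x e)
    (EFin \o (fun y => f y * `|x - y| ^- 2)).
Proof.
move=> [hf _] e0; have [i2 _] := pv_domain_inv2 x e0.
have mD : measurable (pv_domain x e) by exact: measurable_pv_domain.
have -> : EFin \o (fun y => f y * `|x - y| ^- 2) =
   ((fun y => (f x)%:E * (EFin \o (fun y => `|x - y| ^- 2)%R) y) \-
    (EFin \o pv_integrand f x))%E.
  apply/funext => y /=; rewrite -EFinM -EFinB; congr EFin.
  by rewrite /pv_integrand; ring.
by apply: integrableB => //; [exact: integrableZl|exact: hf].
Qed.

Lemma ereal_cvg0_le {R : realType} (a : nat -> \bar R) (e : R) : 0 < e ->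
  a n @[n --> \oo] --> (0 : \bar R)%E -> exists2 N, (1 <= N)%N & (a N <= e%:E)%E.
Proof.
move=> e0 a0.
have H : nbhs (0%:E : \bar R) [set y | (y <= e%:E)%E].
  have h : \forall y \near (0 : R), (y%:E <= e%:E)%E.
    by near=> y; rewrite lee_fin; apply: ltW; near: y; exact: lt_nbhsl.
  exact: h.
have [N _ HN] := a0 _ H.
by exists N.+1 => //; apply: HN; exact: leqnSn.
Unshelve. all: by end_near. Qed.

Lemma solution_tail {R : realType} (T : \bar R) (u : R -> R -> R)
    (s t1 t2 dl : R) : positive_classical_solution T u ->
  0 < s -> s <= t1 -> t1 < t2 -> (t2%:E < T)%E -> 0 < dl ->
  exists2 X0, 0 < X0 & forall X t, X0 <= X -> s <= t -> t <= t1 ->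
    (@lebesgue_measure R).-integrable (pv_domain 0 X)
      (EFin \o (fun y => u y t * `|0 - y| ^- 2)) /\
    \int[lebesgue_measure]_(y in pv_domain 0 X) (u y t * `|0 - y| ^- 2) <= dl.
Proof.
move=> hu s0 st1 t12 t2T dl0.
have [C C0 HC] := solution_unit_mass hu s0 st1 t12 t2T.
have tT t : s <= t -> t <= t2 -> (0 < t) /\ (t%:E < T)%E.
  by move=> st tt; split; [lra|rewrite (le_lt_trans _ t2T)// lee_fin].
have ci t X : s <= t -> t <= t2 -> 0 < X ->
    (@lebesgue_measure R).-integrable (pv_domain 0 X)
      (EFin \o (fun y => u y t * `|0 - y| ^- 2)).
  move=> st tt X0; have [t0 tT'] := tT t st tt.
  have [l hl _] := solution_solves hu 0 t0 tT'.
  exact: integrable_half_laplacian_tail hl X0.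
have cu t : s <= t -> t <= t2 -> continuous (u^~ t).
  by move=> st tt; have [t0 tT'] := tT t st tt; exact: (solution_continuous hu).
have u0 t x : s <= t -> t <= t2 -> 0 <= u x t.
  by move=> st tt; have [t0 tT'] := tT t st tt; exact/ltW/(solution_gt0 hu).
(* Folding both tails onto the positive half-line lets them be cut into the cells from [n] to
   [n + 1]. *)
pose f t z := u z t + u (- z) t.
have cf t : s <= t -> t <= t2 -> continuous (f t).
  move=> st tt z; apply: cvgD; first exact: cu.
  by apply: (continuous_comp_oppr (cu t st tt)).
have f0 t z : s <= t -> t <= t2 -> 0 <= f t z by move=> st tt; rewrite addr_ge0 ?u0.
have fold t X : s <= t -> t <= t2 -> 0 < X ->
    (@lebesgue_measure R).-integrable `]X, +oo[ (EFin \o (fun z => f t z * z ^- 2)) /\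
    \int[lebesgue_measure]_(y in pv_domain 0 X) (u y t * `|0 - y| ^- 2) =
    \int[lebesgue_measure]_(z in `]X, +oo[) (f t z * z ^- 2).
  move=> st tt X0; have := ci t X st tt X0; rewrite pv_domainE => i1.
  have [ip im] := integrable_shell (measurable_itv _) (itv_oy_pos X0) i1.
  have E z : u (0 + z) t / `|0 - (0 + z)| ^+ 2 + u (0 - z) t / `|0 - (0 - z)| ^+ 2
      = f t z * z ^- 2.
    by rewrite subKr add0r !sub0r normrN !real_normK ?num_real// /f; ring.
  split.
    rewrite (_ : EFin \o _ = ((EFin \o (fun z => u (0 + z) t / `|0 - (0 + z)| ^+ 2)%R) \+
      (EFin \o (fun z => u (0 - z) t / `|0 - (0 - z)| ^+ 2)%R))%E).
      exact: integrableD.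
    by apply/funext => z /=; rewrite -EFinD E.
  rewrite Rintegral_shell//; last exact: itv_oy_pos.
  by apply: eq_Rintegral => z _; exact: E.
have st2 : s <= t2 by lra.
(* The folded rays are open, whereas the cells start at the closed endpoint 1; the ray from [1 / 2]
   contains them. *)
have half0 : 0 < 1 / 2 :> R by [].
have [ig _] := fold t2 (1 / 2) st2 (lexx t2) half0.
have ig1 : (@lebesgue_measure R).-integrable `[1, +oo[
    (EFin \o (fun z => f t2 z * z ^- 2)).
  apply: integrableS ig => // z /=; rewrite !in_itv/= !andbT; lra.
have G0 z : (0 <= (f t2 z * z ^- 2)%:E)%E.
  by rewrite lee_fin mulr_ge0 ?f0// invr_ge0 sqr_ge0.
have cvgG : (\int[lebesgue_measure]_(z in `[N%:R, +oo[) (f t2 z * z ^- 2)%:E)%E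
    @[N --> \oo] --> (0 : \bar R)%E.
  apply: ge0_integral_tail_cvg => //.
    exact: measurable_int ig1.
  move/integrableP : ig1 => [_].
  have -> // : (\int[lebesgue_measure]_(z in `[1%R, +oo[)
      `|(EFin \o (fun z => f t2 z * z ^- 2)%R) z| =
    \int[lebesgue_measure]_(z in `[1%R, +oo[) (f t2 z * z ^- 2)%:E)%E.
  by apply: eq_integral => z _; rewrite /= ger0_norm// -lee_fin.
have e0 : 0 < dl / (4 * C) by rewrite divr_gt0// mulr_gt0.
have [N N1 HN] := ereal_cvg0_le e0 cvgG.
have N0 : (0 : R) < N%:R by rewrite ltr0n.
exists N%:R => // X t NX st tt1.
have tt2 : t <= t2 by lra.
have X0 : 0 < X by exact: lt_le_trans NX.
split; first exact: ci.
have [iX ->] := fold t X st tt2 X0.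
have mass (n : nat) x : n%:R <= x -> x <= n.+1%:R ->
    (\int[lebesgue_measure]_(z in `[n%:R, n.+1%:R[) (f t z)%:E <= (C * f t2 x)%:E)%E.
  move=> nx xn; have n1 : n.+1%:R = n%:R + 1 :> R by rewrite -natr1.
  have iu : (@lebesgue_measure R).-integrable `[n%:R, n.+1%:R] (EFin \o u^~ t).
    by apply: integrable_itv_continuous; exact: cu.
  have cm : continuous (fun z => u (- z) t).
    exact: (continuous_comp_oppr (cu t st tt2)).
  have im : (@lebesgue_measure R).-integrable `[n%:R, n.+1%:R] (EFin \o (fun z => u (- z) t)).
    exact: integrable_itv_continuous.
  have iff : (@lebesgue_measure R).-integrable `[n%:R, n.+1%:R] (EFin \o f t).
    by apply: integrable_itv_continuous; exact: cf.
  rewrite integral_itv_bndo_bndc; last first.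
    apply/measurable_EFinP; apply: measurable_funTS.
    by apply: continuous_measurable_fun; exact: cf.
  have -> : (\int[lebesgue_measure]_(z in `[n%:R, n.+1%:R]) (f t z)%:E)%E =
     (\int[lebesgue_measure]_(z in `[n%:R, n.+1%:R]) f t z)%:E.
    by rewrite /Rintegral fineK//; exact: integrable_fin_num.
  rewrite lee_fin /f RintegralD// mulrDr lerD//.
    by rewrite n1; apply: HC => //; lra.
  (* The reflected cell is again a unit interval, now containing [- x], so [HC] applies to it
     too. *)
  have -> : \int[lebesgue_measure]_(z in `[n%:R, n.+1%:R]) u (- z) t =
      \int[lebesgue_measure]_(z in `[- n.+1%:R, - n.+1%:R + 1]) u z t.
    rewrite /Rintegral; congr fine.
    have -> : - n.+1%:R + 1 = - n%:R :> R by rewrite n1; ring.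
    rewrite (@integration_by_substitution_oppr _ (u^~ t))//; first by rewrite ler_nat.
    by apply: continuous_subspaceT; exact: cu.
  by apply: HC => //; lra.
have main := ge0_integral_tail_compare (cf t st tt2) (cf t2 st2 (lexx _))
  (fun z => f0 t z st tt2) (fun z => f0 t2 z st2 (lexx _)) (ltW C0) mass N1.
have F0 z : (0 <= (f t z * z ^- 2)%:E)%E.
  by rewrite lee_fin mulr_ge0 ?f0// invr_ge0 sqr_ge0.
have bound : (\int[lebesgue_measure]_(z in `]X, +oo[) (f t z * z ^- 2)%:E <= dl%:E)%E.
  apply: (@le_trans _ _ (\int[lebesgue_measure]_(z in `[N%:R, +oo[) (f t z * z ^- 2)%:E)%E).
    have [iN _] := fold t (N%:R / 2) st tt2 (divr_gt0 N0 (ltr0Sn _ 1)).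
    apply: (@ge0_subset_integral _ (measurableTypeR R) R lebesgue_measure) => //.
      have mN := measurable_int _ iN.
      apply: measurable_funS mN => // z /=; rewrite !in_itv/= !andbT; lra.
    move=> z /=; rewrite !in_itv/= !andbT => Xz; exact: (le_trans NX (ltW Xz)).
  apply: (le_trans main).
  have -> : dl%:E = ((4 * C)%:E * (dl / (4 * C))%:E)%E.
    by rewrite -EFinM mulrC divfK// gt_eqF// mulr_gt0.
  by apply: lee_pmul => //; [rewrite lee_fin mulr_ge0// ltW|apply: integral_ge0].
rewrite /Rintegral -lee_fin fineK//.
exact: integrable_fin_num.
Qed.

(** * The Harnack constant *)

(* exp of the hyperbolic distance between (0, t1) and (d, t2) in the half-plane. *)
Definition harnack_const {R : realType} (t1 t2 d : R) : R :=
  (d ^+ 2 + t1 ^+ 2 + t2 ^+ 2 + Num.sqrt (kappa0 t1 t2 d)) / (2 * t1 * t2).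

Lemma kappa0E {R : realType} (t1 t2 d : R) :
  kappa0 t1 t2 d = (d ^+ 2 + t1 ^+ 2 + t2 ^+ 2) ^+ 2 - 4 * t1 ^+ 2 * t2 ^+ 2.
Proof. by rewrite /kappa0 !real_normK ?num_real//; ring. Qed.

Lemma kappa0_ge0 {R : realType} (t1 t2 d : R) : 0 <= kappa0 t1 t2 d.
Proof. by rewrite /kappa0 mulr_ge0// addr_ge0 ?sqr_ge0// exprn_ge0. Qed.

Lemma kappa0C {R : realType} (t1 t2 d : R) : kappa0 t1 t2 d = kappa0 t2 t1 d.
Proof. by rewrite !kappa0E; ring. Qed.

(** [kappa0] exceeds the square of the expression in the norm by [(2 * t2 * d) ^+ 2]. Adding that
    expression to the root gives [low_den], subtracting it gives [up_den]. *)
Lemma sqrt_kappa0_gt {R : realType} (t1 t2 d : R) : 0 < t2 -> 0 < d ->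
  `|d ^+ 2 + t1 ^+ 2 - t2 ^+ 2| < Num.sqrt (kappa0 t1 t2 d).
Proof.
move=> t20 d0; rewrite -sqrtr_sqr ltr_sqrt kappa0E.
  rewrite -subr_gt0.
  have -> : (d ^+ 2 + t1 ^+ 2 + t2 ^+ 2) ^+ 2 - 4 * t1 ^+ 2 * t2 ^+ 2 -
    (d ^+ 2 + t1 ^+ 2 - t2 ^+ 2) ^+ 2 = (2 * t2 * d) ^+ 2 by ring.
  by rewrite exprn_gt0// !mulr_gt0.
have -> : (d ^+ 2 + t1 ^+ 2 + t2 ^+ 2) ^+ 2 - 4 * t1 ^+ 2 * t2 ^+ 2 =
    (d ^+ 2 + t1 ^+ 2 - t2 ^+ 2) ^+ 2 + (2 * t2 * d) ^+ 2 by ring.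
by rewrite ltr_wpDl ?sqr_ge0// exprn_gt0// !mulr_gt0.
Qed.

Lemma harnack_constC {R : realType} (t1 t2 d : R) :
  harnack_const t1 t2 d = harnack_const t2 t1 d.
Proof. by rewrite /harnack_const kappa0C; congr (_ / _); ring. Qed.

Lemma harnack_const_gt0 {R : realType} (t1 t2 d : R) : 0 < t1 -> 0 < t2 ->
  0 < harnack_const t1 t2 d.
Proof.
move=> t10 t20; rewrite divr_gt0 ?mulr_gt0// ltr_pwDl ?sqrtr_ge0//.
by rewrite ltr_wpDl ?exprn_gt0// addr_ge0 ?sqr_ge0.
Qed.

(** Equivalently [K + K^-1 = (d^2 + t1^2 + t2^2) / (t1 * t2)], which is twice the hyperbolic cosine
    of the distance. *)
Lemma harnack_const_root {R : realType} (t1 t2 d : R) : 0 < t1 -> 0 < t2 ->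
  t1 * t2 * harnack_const t1 t2 d ^+ 2 -
  (d ^+ 2 + t1 ^+ 2 + t2 ^+ 2) * harnack_const t1 t2 d + t1 * t2 = 0.
Proof.
move=> t10 t20; rewrite /harnack_const.
have := sqr_sqrtr (kappa0_ge0 t1 t2 d); rewrite kappa0E.
move: (Num.sqrt _) => S HS.
set b := _ + _ + t2 ^+ 2 in HS *.
have -> : t1 * t2 * ((b + S) / (2 * t1 * t2)) ^+ 2 - b * ((b + S) / (2 * t1 * t2)) + t1 * t2
  = (S ^+ 2 - (b ^+ 2 - 4 * t1 ^+ 2 * t2 ^+ 2)) / (4 * t1 * t2).
  by field; rewrite !gt_eqF.
by rewrite HS subrr mul0r.
Qed.

(** [K * t1 - t2] is the leading coefficient, in [p], of the quadratic that compares two kernels;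
    the bound makes it positive as soon as [d != 0]. *)
Lemma harnack_const_lead {R : realType} (t1 t2 d : R) : 0 < t1 -> 0 < t2 ->
  d ^+ 2 / (2 * t2) <= harnack_const t1 t2 d * t1 - t2.
Proof.
move=> t10 t20.
have h : t2 ^+ 2 - t1 ^+ 2 <= Num.sqrt (kappa0 t1 t2 d).
  apply: (le_trans (ler_norm _)); rewrite -sqrtr_sqr ler_sqrt ?kappa0_ge0//.
  rewrite kappa0E -subr_ge0.
  have -> : (d ^+ 2 + t1 ^+ 2 + t2 ^+ 2) ^+ 2 - 4 * t1 ^+ 2 * t2 ^+ 2 -
    (t2 ^+ 2 - t1 ^+ 2) ^+ 2 = d ^+ 2 * (d ^+ 2 + 2 * (t1 ^+ 2 + t2 ^+ 2)) by ring.
  by rewrite mulr_ge0 ?sqr_ge0// addr_ge0 ?sqr_ge0// mulr_ge0// addr_ge0 ?sqr_ge0.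
rewrite /harnack_const; move: h; move: (Num.sqrt _) => S h.
have -> : (d ^+ 2 + t1 ^+ 2 + t2 ^+ 2 + S) / (2 * t1 * t2) * t1 - t2 =
  (d ^+ 2 + t1 ^+ 2 - t2 ^+ 2 + S) / (2 * t2) by field; rewrite !gt_eqF.
by rewrite ler_pM2r ?invr_gt0 ?mulr_gt0//; lra.
Qed.

(** Completing the square: the two sides differ by [t1 * t2] times the quadratic polynomial of which
    [K] is a root. *)
Lemma harnack_const_square {R : realType} (t1 t2 d p : R) : 0 < t1 -> 0 < t2 ->
  let K := harnack_const t1 t2 d in
  (K * t1 - t2) * (K * t1 * (t2 ^+ 2 + (p + d) ^+ 2) - t2 * (t1 ^+ 2 + p ^+ 2)) =
  ((K * t1 - t2) * p + K * t1 * d) ^+ 2.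
Proof.
move=> t10 t20 K; apply/eqP; rewrite -subr_eq0; apply/eqP.
have := harnack_const_root d t10 t20; rewrite -/K => HK.
rewrite -(mulr0 (t1 * t2)) -HK; ring.
Qed.

Lemma harnack_const_norm {R : realType} (t1 t2 d : R) :
  harnack_const t1 t2 `|d| = harnack_const t1 t2 d.
Proof. by rewrite /harnack_const /kappa0 !real_normK ?num_real. Qed.

Lemma heat_kernel_harnack {R : realType} (t1 t2 x1 x2 z : R) : 0 < t1 -> 0 < t2 ->
  heat_kernel (x2 - z) t2 <=
  harnack_const t1 t2 (x2 - x1) * heat_kernel (x1 - z) t1.
Proof.
move=> t10 t20; rewrite !heat_kernelE//.
set d := x2 - x1; set p := x1 - z; have -> : x2 - z = p + d by rewrite /p /d; ring.
have pos1 : 0 < t1 ^+ 2 + p ^+ 2 by rewrite ltr_pwDl ?exprn_gt0 ?sqr_ge0.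
have pos2 : 0 < t2 ^+ 2 + (p + d) ^+ 2 by rewrite ltr_pwDl ?exprn_gt0 ?sqr_ge0.
have P0 := pi_gt0 R.
set K := harnack_const t1 t2 d.
suff H : t2 * (t1 ^+ 2 + p ^+ 2) <= K * t1 * (t2 ^+ 2 + (p + d) ^+ 2).
  rewrite -subr_ge0.
  have -> : K * (t1 / pi / (t1 ^+ 2 + p ^+ 2)) - t2 / pi / (t2 ^+ 2 + (p + d) ^+ 2) =
    (K * t1 * (t2 ^+ 2 + (p + d) ^+ 2) - t2 * (t1 ^+ 2 + p ^+ 2)) /
    (pi * (t1 ^+ 2 + p ^+ 2) * (t2 ^+ 2 + (p + d) ^+ 2)).
    by move: (pi : R) P0 => P P0; field; rewrite !gt_eqF.
  by rewrite divr_ge0 ?subr_ge0//; apply/ltW; rewrite !mulr_gt0.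
have lead := harnack_const_lead d t10 t20; rewrite -/K in lead.
(* For [d = 0] the leading coefficient may vanish, so the perfect square cannot be divided by it;
   the bounds [t2 <= K * t1] and [t1 <= K * t2] are enough. *)
have [d0|d0] := eqVneq d 0.
  have lead2 := harnack_const_lead d t20 t10.
  rewrite harnack_constC -/K in lead2; move: lead lead2.
  rewrite d0 expr0n/= mul0r addr0 => h1 h2.
  have := sqr_ge0 p => p2.
  have h3 : t1 * t2 * t1 <= t1 * t2 * (K * t2) by rewrite ler_pM2l ?mulr_gt0//; lra.
  have h4 : 0 <= (K * t1 - t2) * p ^+ 2 by rewrite mulr_ge0.
  lra.
have A0 : 0 < K * t1 - t2.
  by apply: lt_le_trans lead; apply: divr_gt0; [rewrite exprn_even_gt0|exact: mulr_gt0].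
rewrite -subr_ge0 -(pmulr_rge0 _ A0) harnack_const_square//; exact: sqr_ge0.
Qed.

Lemma kernel_sum_harnack {R : realType} (S : seq (R * R)) (t1 t2 x1 x2 : R) :
  0 < t1 -> 0 < t2 -> all (fun p => 0 <= p.1) S ->
  kernel_sum S x2 t2 <= harnack_const t1 t2 (x2 - x1) * kernel_sum S x1 t1.
Proof.
move=> t10 t20 /allP S0; rewrite /kernel_sum mulr_sumr big_seq [leRHS]big_seq.
apply: ler_sum => p pS; rewrite [leRHS]mulrCA ler_wpM2l ?S0//.
exact: heat_kernel_harnack.
Qed.

Lemma continuous_harnack_const {R : realType} (t1 t2 d : R) : 0 < t1 -> 0 < t2 ->
  harnack_const (t1 + r) (t2 + r) d @[r --> (0 : R)] --> harnack_const t1 t2 d.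
Proof.
move=> t10 t20.
have c (a : R) : (a + r) @[r --> (0 : R)] --> a.
  rewrite -[X in _ --> X]addr0.
  by apply: cvgD; [exact: cvg_cst|exact: cvg_id].
have c2 (a : R) : ((a + r) ^+ 2) @[r --> (0 : R)] --> a ^+ 2 by apply: cvgM; exact: c.
have cs : ((d ^+ 2 + (t1 + r) ^+ 2 + (t2 + r) ^+ 2)) @[r --> (0 : R)] -->
    (d ^+ 2 + t1 ^+ 2 + t2 ^+ 2).
  by apply: cvgD => //; apply: cvgD => //; exact: cvg_cst.
have ck : kappa0 (t1 + r) (t2 + r) d @[r --> (0 : R)] --> kappa0 t1 t2 d.
  rewrite kappa0E (_ : (fun _ => _) = (fun r => (d ^+ 2 + (t1 + r) ^+ 2 + (t2 + r) ^+ 2)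
     * (d ^+ 2 + (t1 + r) ^+ 2 + (t2 + r) ^+ 2)
     - 4 * (t1 + r) ^+ 2 * (t2 + r) ^+ 2)); last first.
    by apply/funext => r; rewrite kappa0E expr2.
  rewrite [X in X - _]expr2; apply: cvgB; first exact: cvgM.
  by apply: cvgM => //; apply: cvgM => //; exact: cvg_cst.
apply: cvgM.
  apply: cvgD => //.
  exact: (cvg_comp _ _ ck (@sqrt_continuous R _)).
apply: cvgV; first by rewrite gt_eqF// !mulr_gt0.
by apply: cvgM => //; apply: cvgM => //; exact: cvg_cst.
Qed.

(** * Approximation of solutions and the Harnack inequality *)

Lemma barrier_le1 {R : realType} (X x : R) : 2 * x ^+ 2 + 1 <= X ->
  `|x| < X /\ barrier X x <= 1.
Proof.
move=> xX; have x2 := sqr_ge0 x.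
have xX' : `|x| < X.
  have e : x ^+ 2 = `|x| ^+ 2 by rewrite real_normK ?num_real.
  by rewrite e in xX x2; have := sqr_ge0 (`|x| - 1); have := normr_ge0 x; nra.
split => //; have h := sqr_lt_norm xX'.
rewrite /barrier ler_pdivrMr// mul1r.
nra.
Qed.

Lemma ereal_between {R : realType} (t : R) (T : \bar R) : (t%:E < T)%E ->
  exists2 t', t < t' & (t'%:E < T)%E.
Proof.
case: T => [r| |]//; rewrite ?lte_fin => tr.
- by exists ((t + r) / 2); rewrite ?lte_fin; lra.
- by exists (t + 1); [lra|exact: ltry].
Qed.

(* Widder-type uniqueness: u is determined by its values at time s, being a
   locally uniform limit of superpositions of heat kernels. *)
Lemma solution_kernel_sum {R : realType} (T : \bar R) (u : R -> R -> R)
    (s tm Y e eps0 : R) : positive_classical_solution T u ->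
  0 < s -> s <= tm -> (tm%:E < T)%E -> 0 < e -> 0 < eps0 ->
  exists eps (S : seq (R * R)), [/\ 0 < eps < eps0, all (fun p => 0 <= p.1) S &
    forall x t, `|x| <= Y -> s <= t -> t <= tm ->
      `|kernel_sum S x (t + (eps - s)) - u x t| <= e].
Proof.
move=> hu s0 stm tmT e0 eps00.
(* Tails up to time [tm] are controlled by the values at a strictly later time. *)
have [t3 tm3 t3T] := ereal_between tmT.
have st0 t : s <= t -> 0 < t by exact: lt_le_trans.
have tm0 : 0 < tm by exact: st0.
have m0 : 0 < 1 + 12 * tm by rewrite addr_gt0// mulr_gt0.
(* On [|x| <= Y] the barrier is at most 1, so this choice bounds the whole barrier term by
   [e / 2]. *)
pose D := 2 * (40 ^+ 2 * (1 + 12 * tm)).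
have D0 : 0 < D by rewrite mulr_gt0// mulr_gt0// exprn_gt0.
pose dl := e / D.
have dl0 : 0 < dl by rewrite divr_gt0.
have dlE : 40 ^+ 2 * dl * (1 + 12 * tm) = e / 2.
  rewrite /dl /D; move: (1 + 12 * tm) m0 => m m0; field; exact: lt0r_neq0.
have [X0 X00 HX0] := solution_tail hu s0 stm tm3 t3T (divr_gt0 dl0 (ltr0Sn _ 1)).
have [X [XX X1 XY]] : exists X, [/\ X0 <= X / 2, 1 <= X &
    forall x, `|x| <= Y -> `|x| < X /\ barrier X x <= 1].
  exists (Num.max (2 * X0) (2 * Y ^+ 2 + 1)); split.
  - by rewrite ler_pdivlMr// mulrC le_max lexx.
  - by rewrite le_max lerDr mulr_ge0 ?sqr_ge0// orbT.
  - move=> x xY; apply: barrier_le1; rewrite le_max; apply/orP; right.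
    rewrite lerD2r ler_pM2l// -[x ^+ 2]real_normK ?num_real//.
    by rewrite lerXn2r ?nnegrE// (le_trans _ xY).
have Xpos : 0 < X by exact: lt_le_trans X1.
have X2 : 0 < X / 2 by rewrite divr_gt0.
(* The constant [eta] has tail integral [4 * eta / X], at most [dl / 2] since [X >= 1]; the other
   half of [dl] is left for the tail of [u]. *)
pose eta := Num.min (e / 2) (dl / 8).
have eta0 : 0 < eta by rewrite !lt_min !divr_gt0.
have eta1 : eta <= e / 2 by rewrite ge_min lexx.
have eta2 : eta <= dl / 8 by rewrite ge_min lexx orbT.
clearbody eta.
have eta3 : eta * (2 / (X / 2)) <= dl / 2.
  rewrite mulrA ler_pdivrMr//; apply: (@le_trans _ _ (dl / 4)); first by lra.
  have -> : dl / 2 * (X / 2) = dl * X / 4 by field.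
  by rewrite ler_pM2r ?invr_gt0// ler_peMr// ltW.
have [eps [S [/andP[eps1 eps2] S0 _ Sz Su]]] :=
  @kernel_minorant R T u hu s tm 0 X eta eps0 s0 tmT stm (ltW Xpos) eta0 eps00.
exists eps, S; split=> //; first by rewrite eps1.
pose r := eps - s.
have tr t : s <= t -> 0 < t + r.
  by move=> st; rewrite /r addrCA ltr_pwDl// subr_ge0.
have tlt t : t <= tm -> (t%:E < T)%E.
  by move=> tt; rewrite (le_lt_trans _ tmT)// lee_fin.
have w0 x t : s <= t -> t <= tm -> 0 <= gap u S r eta x t.
  by move=> st tt; rewrite gapE subr_ge0; exact: Su.
have wX x : `|x| < X -> gap u S r eta x s <= 2 * eta.
  move=> xX; rewrite gapE /r [s + _]addrC subrK.
  have : `|x - 0| <= X by rewrite subr0 ltW.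
  by move=> /Sz; rewrite ler_norml => /andP[+ _]; move: (kernel_sum _ _ _) => q; lra.
have wI t : s < t -> t <= tm ->
    (@lebesgue_measure R).-integrable (pv_domain 0 (X / 2))
      (EFin \o (fun y => gap u S r eta y t * `|0 - y| ^- 2)) /\
    \int[lebesgue_measure]_(y in pv_domain 0 (X / 2))
      (gap u S r eta y t * `|0 - y| ^- 2) <= dl.
  move=> st tt.
  have [l hl _] : solves (gap u S r eta) 0 t.
    by apply: (gap_solves hu); [exact: st0 (ltW st)|exact: tlt|exact: tr (ltW st)].
  have ig := integrable_half_laplacian_tail hl X2.
  split => //.
  have [iu Iu] := HX0 _ t XX (ltW st) tt.
  have [i2 I2] := pv_domain_inv2 0 X2.
  have mD : measurable (pv_domain 0 (X / 2)) by exact: measurable_pv_domain.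
  have ie : (@lebesgue_measure R).-integrable (pv_domain 0 (X / 2))
      (EFin \o (fun y => eta * `|0 - y| ^- 2)).
    rewrite (_ : EFin \o _ = (fun y => eta%:E * (EFin \o (fun y => `|0 - y| ^- 2)%R) y)%E)//.
    exact: integrableZl.
  apply: (@le_trans _ _ (\int[lebesgue_measure]_(y in pv_domain 0 (X / 2))
    (u y t * `|0 - y| ^- 2 + eta * `|0 - y| ^- 2))).
    apply: le_Rintegral => //.
      rewrite (_ : EFin \o _ = ((EFin \o (fun y => u y t * `|0 - y| ^- 2)%R) \+
        (EFin \o (fun y => eta * `|0 - y| ^- 2)%R))%E)//.
      exact: integrableD.
    move=> y _; rewrite -mulrDl ler_wpM2r ?invr_ge0 ?exprn_ge0// gapE.
    by rewrite gerBl; apply: kernel_sum_ge0 => //; exact: tr (ltW st).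
  rewrite RintegralD// RintegralZl// I2.
  by apply: (le_trans (lerD Iu eta3)); rewrite -splitr.
move=> x t xY st tt; have [xX bx] := XY x xY.
have barr : gap u S r eta x t <= 2 * eta + 40 ^+ 2 * dl * (barrier X x + 12 * (t - s)).
  apply: (@barrier_comparison _ (gap u S r eta) s tm _ X dl) => //.
  - by rewrite mulr_ge0// ltW.
  - by move=> Z; apply: (gap_box hu) => //; exact: tr.
  - by move=> y v sv vt; apply: (gap_solves hu);
      [exact: st0 (ltW sv)|exact: tlt|exact: tr (ltW sv)].
have b1 : 40 ^+ 2 * dl * (barrier X x + 12 * (t - s)) <= e / 2.
  rewrite -dlE ler_pM2l; last by rewrite mulr_gt0// exprn_gt0.
  rewrite lerD// ler_pM2l//; clear -s0 tt; lra.
have v1 := Su x t st tt.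
rewrite gapE in barr; rewrite ler_norml -/r in v1 *.
by move: v1 barr b1 eta1; clear; move: (kernel_sum _ _ _) (_ * _ * (_ + _)) => A B; lra.
Qed.

Lemma solution_harnack {R : realType} (T : \bar R) (u : R -> R -> R)
    (t1 t2 x1 x2 : R) : positive_classical_solution T u ->
  0 < t1 -> (t1%:E < T)%E -> 0 < t2 -> (t2%:E < T)%E ->
  u x2 t2 <= harnack_const t1 t2 (x2 - x1) * u x1 t1.
Proof.
move=> hu t10 t1T t20 t2T.
apply/ler_addgt0Pr => e e0.
set K := harnack_const t1 t2 (x2 - x1).
have K0 : 0 < K by exact: harnack_const_gt0.
have u10 : 0 < u x1 t1 by exact: (solution_gt0 hu).
pose th := e / (4 * (u x1 t1 + 1)).
have u11 : 0 < 4 * (u x1 t1 + 1) by lra.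
have th0 : 0 < th by rewrite divr_gt0.
have thE : th * (4 * (u x1 t1 + 1)) = e by rewrite divfK// gt_eqF.
have [rho rho0 Hrho] : exists2 rho, 0 < rho & forall r, `|r| < rho ->
    harnack_const (t1 + r) (t2 + r) (x2 - x1) <= K + th.
  have /cvgrPdist_le/(_ _ th0)/nbhs_ballP[rho /= rho0 H] :=
    continuous_harnack_const (d := x2 - x1) t10 t20.
  exists rho => // r rr; have := H r; rewrite /ball/= sub0r normrN => /(_ rr).
  by rewrite ler_norml -/K => /andP[]; lra.
pose eta := Num.min 1 (e / (4 * (K + 1))).
have K1 : 0 < 4 * (K + 1) by lra.
have eta0 : 0 < eta by rewrite lt_min ltr01 divr_gt0.
have eta1 : eta <= 1 by rewrite ge_min lexx.
have eta2 : eta * (4 * (K + 1)) <= e.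
  by rewrite -ler_pdivlMr// ge_min lexx orbT.
have b3 : th * eta <= th by rewrite ler_piMr// ltW.
clearbody eta th.
pose tm := Num.max t1 t2.
have t1m : t1 <= tm by rewrite le_max lexx.
have t2m : t2 <= tm by rewrite le_max lexx orbT.
have tmT : (tm%:E < T)%E by rewrite /tm; case: (leP t1 t2).
(* As [eps] is also below [rho / 2], the shift satisfies [|eps - s| < rho], and both times come
   after [s]. *)
pose s := Num.min (rho / 2) (Num.min (t1 / 2) (t2 / 2)).
have s0 : 0 < s by rewrite !lt_min !divr_gt0.
have srho : s <= rho / 2 by rewrite ge_min lexx.
have st1 : s <= t1 by apply: (@le_trans _ _ (t1 / 2)); [rewrite !ge_min lexx orbT|lra].
have st2 : s <= t2 by apply: (@le_trans _ _ (t2 / 2)); [rewrite !ge_min lexx !orbT|lra].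
have stm : s <= tm by exact: le_trans t1m.
clearbody s tm.
have rho2 : 0 < rho / 2 by rewrite divr_gt0.
pose Y := Num.max `|x1| `|x2|.
have x1Y : `|x1| <= Y by rewrite le_max lexx.
have x2Y : `|x2| <= Y by rewrite le_max lexx orbT.
have [eps [S [/andP[eps0 eps1] S0 HS]]] :=
  solution_kernel_sum Y hu s0 stm tmT eta0 rho2.
have rr : `|eps - s| < rho by rewrite ltr_norml; lra.
have := HS x1 t1 x1Y st1 t1m; have := HS x2 t2 x2Y st2 t2m.
rewrite !ler_norml => /andP[v2 _] /andP[_ v1].
have r1 : 0 < t1 + (eps - s) by lra.
have r2 : 0 < t2 + (eps - s) by lra.
have har : kernel_sum S x2 (t2 + (eps - s)) <=
    (K + th) * kernel_sum S x1 (t1 + (eps - s)).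
  apply: (le_trans (kernel_sum_harnack x1 x2 r1 r2 S0)).
  by apply: ler_wpM2r; [exact: kernel_sum_ge0|exact: Hrho].
have b2 : (K + th) * kernel_sum S x1 (t1 + (eps - s)) <= (K + th) * (u x1 t1 + eta).
  rewrite ler_pM2l ?addr_gt0//; lra.
have b4 := le_trans har b2.
move: v2 b4 b3 eta2 thE e0; clear.
move: (kernel_sum _ _ _) (u x1 t1) (u x2 t2) => A a b; lra.
Qed.

(** * Closed forms of the constants and the extremal kernels *)

Lemma sqrt_kappa0_sq {R : realType} (t1 t2 d : R) :
  Num.sqrt (kappa0 t1 t2 d) ^+ 2 =
  (d ^+ 2 + t1 ^+ 2 + t2 ^+ 2) ^+ 2 - 4 * t1 ^+ 2 * t2 ^+ 2.
Proof. by rewrite sqr_sqrtr ?kappa0_ge0// kappa0E. Qed.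

Lemma up_den_gt0 {R : realType} (t1 t2 d : R) : 0 < t2 -> 0 < d ->
  0 < up_den t1 t2 d.
Proof.
move=> t20 d0; have := sqrt_kappa0_gt t1 t20 d0.
by rewrite /up_den ltr_norml => /andP[_]; lra.
Qed.

Lemma low_den_gt0 {R : realType} (t1 t2 d : R) : 0 < t2 -> 0 < d ->
  0 < low_den t1 t2 d.
Proof.
move=> t20 d0; have := sqrt_kappa0_gt t1 t20 d0.
by rewrite /low_den ltr_norml => /andP[+ _]; lra.
Qed.


(** After cross-multiplication the two sides differ by a multiple of [kappa0] minus the square of
    its root. *)
Lemma up_quotient {R : realType} (t1 t2 d : R) : 0 < t1 -> 0 < t2 ->
  up_den t1 t2 d != 0 ->
  up_num t1 t2 d / up_den t1 t2 d = t1 / t2 * harnack_const t1 t2 d.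
Proof.
move=> t10 t20 n0; apply: (mulIf n0); rewrite divfK//.
have := sqrt_kappa0_sq t1 t2 d; rewrite /up_num /up_den /harnack_const.
move: (Num.sqrt _) => S HS; apply/eqP; rewrite -subr_eq0; apply/eqP.
have -> : S + (t2 - t1) * (t2 + t1) + d ^+ 2 - t1 / t2 *
    ((d ^+ 2 + t1 ^+ 2 + t2 ^+ 2 + S) / (2 * t1 * t2)) *
    (S + (t2 - t1) * (t2 + t1) - d ^+ 2) =
  ((d ^+ 2 + t1 ^+ 2 + t2 ^+ 2) ^+ 2 - 4 * t1 ^+ 2 * t2 ^+ 2 - S ^+ 2) / (2 * t2 ^+ 2).
  by field; rewrite !gt_eqF.
by rewrite HS subrr mul0r.
Qed.

Lemma low_quotient {R : realType} (t1 t2 d : R) : 0 < t1 -> 0 < t2 ->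
  low_den t1 t2 d != 0 ->
  low_num t1 t2 d / low_den t1 t2 d = t1 / t2 / harnack_const t1 t2 d.
Proof.
move=> t10 t20 n0; have K0 := harnack_const_gt0 d t10 t20.
have Kn0 : harnack_const t1 t2 d != 0 by rewrite gt_eqF.
apply: (mulIf Kn0); rewrite [RHS]divfK//.
apply: (mulIf n0); rewrite mulrAC divfK//.
have := sqrt_kappa0_sq t1 t2 d; rewrite /low_num /low_den /harnack_const.
move: (Num.sqrt _) => S HS; apply/eqP; rewrite -subr_eq0; apply/eqP.
have -> : (S - (t2 - t1) * (t2 + t1) - d ^+ 2) *
    ((d ^+ 2 + t1 ^+ 2 + t2 ^+ 2 + S) / (2 * t1 * t2)) -
    t1 / t2 * (S - (t2 - t1) * (t2 + t1) + d ^+ 2) =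
  (S ^+ 2 - ((d ^+ 2 + t1 ^+ 2 + t2 ^+ 2) ^+ 2 - 4 * t1 ^+ 2 * t2 ^+ 2)) / (2 * t1 * t2).
  by field; rewrite !gt_eqF.
by rewrite HS subrr mul0r.
Qed.

Lemma harnack_const_cvg0 {R : realType} (t1 t2 : R) :
  harnack_const t1 t2 r @[r --> 0^'+] --> harnack_const t1 t2 0.
Proof.
apply: cvg_at_right_filter.
have c2 : (r ^+ 2) @[r --> (0 : R)] --> (0 : R) ^+ 2 by exact: exprn_continuous.
have ck : kappa0 t1 t2 r @[r --> (0 : R)] --> kappa0 t1 t2 0.
  by apply: cvgM; apply: cvgD => //; exact: cvg_cst.
apply: cvgM; last exact: cvg_cst.
apply: cvgD; last exact: (cvg_comp _ _ ck (@sqrt_continuous R _)).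
by apply: cvgD; [apply: cvgD => //|]; exact: cvg_cst.
Qed.

(** The denominator vanishes only for [x1 = x2]; the quotient formula holds for every [r > 0], so
    the limit prescribed there is the value of the continuous right side at 0. *)
Lemma C_upE {R : realType} (t1 t2 x1 x2 : R) : 0 < t1 -> 0 < t2 ->
  C_up t1 t2 x1 x2 = t1 / t2 * harnack_const t1 t2 (x2 - x1).
Proof.
move=> t10 t20; rewrite /C_up; case: ifPn => [/eqP den0|den0]; last first.
  by rewrite up_quotient// harnack_const_norm.
have d0 : `|x2 - x1| = 0.
  apply/eqP; rewrite eq_le normr_ge0 andbT leNgt; apply/negP => d0.
  by have := up_den_gt0 t1 t20 d0; rewrite den0 ltxx.
have -> : x2 - x1 = 0 by apply/eqP; rewrite -normr_eq0 d0.
apply/cvg_lim; first exact: Rhausdorff.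
apply: cvg_trans (cvgM (cvg_cst (t1 / t2)) (@harnack_const_cvg0 R t1 t2)).
apply: near_eq_cvg; near=> r.
by rewrite up_quotient// gt_eqF// up_den_gt0.
Unshelve. all: by end_near. Qed.

Lemma C_lowE {R : realType} (t1 t2 x1 x2 : R) : 0 < t1 -> 0 < t2 ->
  C_low t1 t2 x1 x2 = t1 / t2 / harnack_const t1 t2 (x2 - x1).
Proof.
move=> t10 t20; rewrite /C_low; case: ifPn => [/eqP den0|den0]; last first.
  by rewrite low_quotient// harnack_const_norm.
have d0 : `|x2 - x1| = 0.
  apply/eqP; rewrite eq_le normr_ge0 andbT leNgt; apply/negP => d0.
  by have := low_den_gt0 t1 t20 d0; rewrite den0 ltxx.
have -> : x2 - x1 = 0 by apply/eqP; rewrite -normr_eq0 d0.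
apply/cvg_lim; first exact: Rhausdorff.
have K0 : harnack_const t1 t2 0 != 0 by rewrite gt_eqF// harnack_const_gt0.
apply: cvg_trans (cvgM (cvg_cst (t1 / t2)) (cvgV K0 (@harnack_const_cvg0 R t1 t2))).
apply: near_eq_cvg; near=> r.
by rewrite low_quotient// gt_eqF// low_den_gt0.
Unshelve. all: by end_near. Qed.

(** Equality holds exactly at the double root in [harnack_const_square], where the square
    vanishes. *)
Lemma kernel_ratio_harnack {R : realType} (t1 t2 x1 x2 z : R) :
  0 < t1 -> 0 < t2 -> x1 != x2 ->
  let K := harnack_const t1 t2 (x2 - x1) in
  kernel_ratio t1 t2 x1 x2 z = K <-> K * t1 * (x2 - z) = t2 * (x1 - z).
Proof.
move=> t10 t20 x12 K.
set d := x2 - x1 in K *; set p := x1 - z.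
have -> : x2 - z = p + d by rewrite /p /d; ring.
have d0 : d != 0 by rewrite subr_eq0 eq_sym.
have pos1 : 0 < t1 ^+ 2 + p ^+ 2 by rewrite ltr_pwDl ?exprn_gt0 ?sqr_ge0.
have pos2 : 0 < t2 ^+ 2 + (p + d) ^+ 2 by rewrite ltr_pwDl ?exprn_gt0 ?sqr_ge0.
have A0 : 0 < K * t1 - t2.
  apply: lt_le_trans (harnack_const_lead d t10 t20).
  by apply: divr_gt0; [rewrite exprn_even_gt0|exact: mulr_gt0].
have rE : kernel_ratio t1 t2 x1 x2 z - K =
    (t2 * (t1 ^+ 2 + p ^+ 2) - K * t1 * (t2 ^+ 2 + (p + d) ^+ 2)) /
    (t1 * (t2 ^+ 2 + (p + d) ^+ 2)).
  rewrite /kernel_ratio !heat_kernelE// -/p (_ : x2 - z = p + d); last first.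
    by rewrite /p /d; ring.
  have := pi_gt0 R; move: (pi : R) => P P0; field.
  by rewrite !gt_eqF.
have sq := harnack_const_square d p t10 t20; rewrite /= -/K in sq.
have lin : (K * t1 - t2) * p + K * t1 * d = K * t1 * (p + d) - t2 * p by ring.
split => H.
  have Q0 : K * t1 * (t2 ^+ 2 + (p + d) ^+ 2) - t2 * (t1 ^+ 2 + p ^+ 2) = 0.
    move/eqP: rE; rewrite H subrr eq_sym mulf_eq0 invr_eq0 [_ || _]orbC.
    by rewrite gt_eqF ?mulr_gt0//= subr_eq0 => /eqP ->; rewrite subrr.
  move: sq; rewrite Q0 mulr0 lin => /esym/eqP; rewrite sqrf_eq0 subr_eq0.
  by move/eqP.
apply/eqP; rewrite -subr_eq0 rE mulf_eq0; apply/orP; left.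
move: sq; rewrite lin H subrr expr0n/= => /eqP; rewrite mulf_eq0 gt_eqF//=.
by rewrite subr_eq0 => /eqP ->; rewrite subrr.
Qed.

(** The witness solves the linear equation of [kernel_ratio_harnack]. For [x1 = x2] and [t1 < t2]
    the supremum of the ratio is only approached as [z] goes to infinity. *)
Lemma kernel_ratio_attained {R : realType} (t1 t2 x1 x2 : R) :
  0 < t1 -> 0 < t2 -> x1 != x2 ->
  exists z, kernel_ratio t1 t2 x1 x2 z = harnack_const t1 t2 (x2 - x1).
Proof.
move=> t10 t20 x12; set K := harnack_const t1 t2 (x2 - x1).
have A0 : 0 < K * t1 - t2.
  apply: lt_le_trans (harnack_const_lead (x2 - x1) t10 t20).
  apply: divr_gt0; last exact: mulr_gt0.
  by rewrite exprn_even_gt0//= subr_eq0 eq_sym.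
exists ((K * t1 * x2 - t2 * x1) / (K * t1 - t2)).
by apply/kernel_ratio_harnack => //; rewrite -/K; field; rewrite gt_eqF.
Qed.

Lemma kernel_ratio_critical {R : realType} (t1 t2 x1 x2 z : R) :
  0 < t1 -> 0 < t2 -> x1 != x2 ->
  kernel_ratio t1 t2 x1 x2 z = harnack_const t1 t2 (x2 - x1) ->
  [/\ x1 - z != 0, x2 - z != 0 &
    t1 / t2 * harnack_const t1 t2 (x2 - x1) = (x1 - z) / (x2 - z)].
Proof.
move=> t10 t20 x12 /kernel_ratio_harnack => /(_ t10 t20 x12) H.
have K0 := harnack_const_gt0 (x2 - x1) t10 t20.
move: (harnack_const _ _ _) H K0 => K H K0.
have x2z : x2 - z != 0.
  apply/eqP => h; move: H; rewrite h mulr0 => /esym/eqP.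
  rewrite mulf_eq0 gt_eqF//= subr_eq0 => /eqP x1z.
  by move: x12; rewrite x1z; move/eqP: h; rewrite subr_eq0 => /eqP ->; rewrite eqxx.
have x1z : x1 - z != 0.
  apply/eqP => h; move: H; rewrite h mulr0 => /eqP.
  by rewrite !mulf_eq0 (gt_eqF K0) (gt_eqF t10) (negbTE x2z).
split => //; apply: (mulIf x2z); rewrite divfK//.
have -> : t1 / t2 * K * (x2 - z) = (K * t1 * (x2 - z)) / t2 by ring.
by rewrite H mulrC mulKf// gt_eqF.
Qed.

Lemma kernel_ratio_swap {R : realType} (t1 t2 x1 x2 z : R) :
  kernel_ratio t1 t2 x1 x2 z = (kernel_ratio t2 t1 x2 x1 z)^-1.
Proof. by rewrite /kernel_ratio invf_div. Qed.

Lemma harnack_constN {R : realType} (t1 t2 x1 x2 : R) :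
  harnack_const t1 t2 (x2 - x1) = harnack_const t2 t1 (x1 - x2).
Proof. by rewrite harnack_constC -harnack_const_norm distrC harnack_const_norm. Qed.

Unset Implicit Arguments.
Set Strict Implicit.

Theorem theorem2p4 (R : realType) (T : \bar R) (hT : (0%:E < T)%E)
  (u : R -> R -> R) (hu : positive_classical_solution T u)
  (t1 t2 x1 x2 : R)
  (ht1 : 0 < t1) (ht1T : (t1%:E < T)%E) (ht2 : 0 < t2) (ht2T : (t2%:E < T)%E) :
  ((t2 / t1) * C_low t1 t2 x1 x2 <= u x2 t2 / u x1 t1 /\
   u x2 t2 / u x1 t1 <= (t2 / t1) * C_up t1 t2 x1 x2) /\
  (x1 <> x2 ->
     ((exists z : R, (t2 / t1) * C_low t1 t2 x1 x2
                     = kernel_ratio t1 t2 x1 x2 z) /\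
      (forall z : R, (t2 / t1) * C_low t1 t2 x1 x2
                     = kernel_ratio t1 t2 x1 x2 z ->
         x2 - z <> 0 /\ C_low t1 t2 x1 x2 = (x1 - z) / (x2 - z))) /\
     ((exists z : R, kernel_ratio t1 t2 x1 x2 z
                     = (t2 / t1) * C_up t1 t2 x1 x2) /\
      (forall z : R, kernel_ratio t1 t2 x1 x2 z
                     = (t2 / t1) * C_up t1 t2 x1 x2 ->
         x2 - z <> 0 /\ C_up t1 t2 x1 x2 = (x1 - z) / (x2 - z)))).
Proof.
rewrite C_lowE// C_upE//.
have K0 := harnack_const_gt0 (x2 - x1) ht1 ht2.
have u1 := solution_gt0 hu x1 ht1 ht1T; have u2 := solution_gt0 hu x2 ht2 ht2T.
have lowE : t2 / t1 * (t1 / t2 / harnack_const t1 t2 (x2 - x1)) =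
    (harnack_const t1 t2 (x2 - x1))^-1 by field; rewrite !gt_eqF.
have upE : t2 / t1 * (t1 / t2 * harnack_const t1 t2 (x2 - x1)) =
    harnack_const t1 t2 (x2 - x1) by field; rewrite !gt_eqF.
split.
  rewrite lowE upE; split; last first.
    by rewrite ler_pdivrMr//; exact: (@solution_harnack R T u t1 t2 x1 x2 hu).
  (* The lower bound is the upper one with the two points exchanged. *)
  rewrite ler_pdivlMr// ler_pdivrMl// harnack_constN.
  exact: (@solution_harnack R T u t2 t1 x2 x1 hu).
move=> /eqP x12; have x21 : x2 != x1 by rewrite eq_sym.
(* Exchanging the points inverts the ratio, so the minimizing centre is the maximizing one of the
   exchanged pair. *)
have swap z : (harnack_const t1 t2 (x2 - x1))^-1 = kernel_ratio t1 t2 x1 x2 z <->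
    kernel_ratio t2 t1 x2 x1 z = harnack_const t2 t1 (x1 - x2).
  rewrite kernel_ratio_swap harnack_constN.
  by split => [/invr_inj ->|->].
split; split.
- have [z Hz] := kernel_ratio_attained ht2 ht1 x21.
  by exists z; rewrite lowE; apply/swap.
- move=> z; rewrite lowE => /swap/(kernel_ratio_critical ht2 ht1 x21)[n1 n2 E].
  split; first exact/eqP.
  rewrite harnack_constN -[RHS]invf_div -E; move: K0; rewrite harnack_constN.
  by move: (harnack_const _ _ _) => K K0; field; rewrite !gt_eqF.
- have [z Hz] := kernel_ratio_attained ht1 ht2 x12.
  by exists z; rewrite upE.
- move=> z; rewrite upE => /(kernel_ratio_critical ht1 ht2 x12)[n1 n2 E].
  by split; [exact/eqP|].
Qed.
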